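(* Let $c>0$ and let $(\beta_n)$ be a sequence in $[0,1)$ with $\lim_{n\to\infty}\beta_n=0$. Then for every $f\in C_{\rho_0}(\mathbb{R}^+)$, $$\lim_{n\to\infty}\|\mathcal{D}_{n,c}^{\beta_n}(f)-f\|_{\rho_0}=0,$$ where the operators are considered for $n>3c$.
   Context: For $\beta\in[0,1)$, $x\ge 0$, $n\in\mathbb{N}$ and integers $v\ge0$ let $\omega_\beta(v,nx)=nx(nx+v\beta)^{v-1}\frac{e^{-(nx+v\beta)}}{v!}$. For $c>0$, integers $v\ge1$ and $t\ge0$ let $p_{n,v-1,c}(t)=c\,\frac{\Gamma(n/c+v-1)}{\Gamma(v)\Gamma(n/c)}\cdot\frac{(ct)^{v-1}}{(1+ct)^{n/c+v-1}}$. The modified Jain-Baskakov operators are $$\mathcal{D}_{n,c}^{\beta}(f,x)=\frac{n-c}{c}\sum_{v=1}^{\infty}\omega_\beta(v,nx)\int_0^\infty p_{n,v-1,c}(t)f(t)\,dt+e^{-nx}f(0).$$ With $\rho_0(x)=1+x^2$, $C_{\rho_0}(\mathbb{R}^+)$ is the set of continuous functions $f$ on $[0,\infty)$ such that $|f(x)|\le M_f(1+x^2)$ for some constant $M_f$ and $f(x)/\rho_0(x)$ converges as $x\to\infty$. The weighted norm is $\|g\|_{\rho_0}=\sup_{x\ge0}\frac{|g(x)|}{1+x^2}$. *)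

(* Defs.v *)
From Stdlib Require Import Reals.
From Coquelicot Require Import Coquelicot.
Open Scope R_scope.

Definition Gamma (s : R) : R :=
  RInt_gen (fun t => Rpower t (s - 1) * exp (- t)) (at_right 0) (Rbar_locally p_infty).

Definition omega (beta : R) (v : nat) (y : R) : R :=
  y * (y + INR v * beta) ^ (v - 1) * exp (- (y + INR v * beta)) / INR (Factorial.fact v).

(* p_{n,v-1,c}(t), for v >= 1 *)
Definition p_nc (n : nat) (v : nat) (c t : R) : R :=
  c * (Gamma (INR n / c + INR v - 1) / (Gamma (INR v) * Gamma (INR n / c)))
    * ((c * t) ^ (v - 1) / Rpower (1 + c * t) (INR n / c + INR v - 1)).

Definition D_op (n : nat) (c beta : R) (f : R -> R) (x : R) : R :=
  (INR n - c) / c *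
    Series (fun k : nat =>
      omega beta (S k) (INR n * x) *
      RInt_gen (fun t => p_nc n (S k) c t * f t) (at_point 0) (Rbar_locally p_infty))
  + exp (- (INR n * x)) * f 0.

Definition rho0 (x : R) : R := 1 + x ^ 2.

Definition C_rho0 (f : R -> R) : Prop :=
  (forall x, 0 <= x -> filterlim f (within (fun y => 0 <= y) (locally x)) (locally (f x)))
  /\ (exists M, forall x, 0 <= x -> Rabs (f x) <= M * rho0 x)
  /\ (exists l : R, is_lim (fun x => f x / rho0 x) p_infty l).

Definition wnorm (g : R -> R) : Rbar :=
  Lub_Rbar (fun r => exists x, 0 <= x /\ r = Rabs (g x) / rho0 x).

(* Main.v *)
(* Each summand is an average of [f]: the weights [omega beta v (n x)] together with [exp (- n x)]
   sum to 1, and [t |-> (n - c) / c * p_nc n v c t] is a probability density.  Hence, once [f] is known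
   to satisfy [|f t - f x| <= e rho0 x + C (t - x)^2], the error at [x] is at most
   [e rho0 x + C D((t - x)^2)(x)], and it remains to see that [D((t - x)^2)(x) / rho0 x] tends to 0
   uniformly in [x].
   The moments of the densities come from the recursion between consecutive Beta integrals and
   [Gamma (s + 1) = s Gamma s].  That the Jain weights sum to 1 is the Abel expansion of [exp]: with
   [A_v(y) = y (y + v beta)^(v - 1) / v!], the remainder of [exp y = sum A_v(y) exp (- v beta)] decays
   geometrically for small [beta], which suffices since [beta n] tends to 0.  Their first two
   moments are only bounded, by induction on the partial sums. *)
Require Import Defs.
From Stdlib Require Import Reals Lra Lia Factorial.
From Coquelicot Require Import Coquelicot.
Open Scope R_scope.

(** * Improper integrals and the Gamma function *)

(** The expression [D((t - x)^2)] is the second moment minus [2 x] times the first plus [x^2]. The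
    first moment of the Jain weights enters with a negative sign, so it is bounded from below and
    the second from above. What results is a polynomial in [x] with terms in [x] and [x^2] only and
    with small coefficients; both powers are at most [rho0 x], and this gives the uniformity in [x].
    The estimate for [f t - f x] comes from [g = f / rho0], which has a limit at infinity and is
    thus uniformly continuous; the quadratic term pays for the pairs [x], [t] that are apart.
    [RInt_gen] and [Series] are total functions whose values carry no information in case of
    divergence. Convergence is therefore proved together with each value. For the integrals of [f]
    it follows by comparison with a multiple of [rho0], whose integrals are finite as soon as
    [n > 3 c]. *)

Lemma RInt_gen_nonneg_bounded (Fa : (R -> Prop) -> Prop) (FFa : Filter Fa)
    (A : R -> Prop) (f : R -> R) (a0 B : R) :
  A a0 ->
  (forall a, A a -> Fa (fun x => A x /\ x <= a)) ->
  (forall a b, A a -> a <= b -> ex_RInt f a b) ->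
  (forall a t, A a -> a <= t -> 0 <= f t) ->
  (forall a b, A a -> a <= b -> RInt f a b <= B) ->
  exists l, is_RInt_gen f Fa (Rbar_locally p_infty) l /\
    forall a b, A a -> a <= b -> RInt f a b <= l.
Proof.
  intros Ha0 HFa Hex Hpos HB.
  (* The limit is the supremum of the integrals over all admissible intervals. [A] is the set of
     admissible lower ends: the positive numbers for [at_right 0], the single number 0 for
     [at_point 0]. *)
  destruct (completeness (fun r => exists a b, A a /\ a <= b /\ r = RInt f a b)) as [l [Hub Hlub]].
  - exists B. intros r (a & b & Ha & Hab & ->). now apply HB.
  - exists (RInt f a0 a0), a0, a0. split; [exact Ha0|]. split; [lra|reflexivity].
  - assert (Hle : forall a b, A a -> a <= b -> RInt f a b <= l).
    { intros a b Ha Hab. apply Hub. now exists a, b. }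
    exists l. split; [|exact Hle].
    intros P [eps HP].
    assert (Hnear : exists a b, A a /\ a <= b /\ l - eps < RInt f a b).
    { apply Classical_Prop.NNPP. intros Hno.
      assert (l <= l - eps); [|destruct eps; simpl in *; lra].
      apply Hlub. intros r (a & b & Ha & Hab & ->).
      apply Rnot_lt_le. intros Hlt. apply Hno. now exists a, b. }
    destruct Hnear as (a1 & b1 & Ha1 & Hab1 & Hlt).
    apply Filter_prod with (fun x => A x /\ x <= a1) (fun y => b1 < y).
    + now apply HFa.
    + now exists b1.
    + intros x y [Hx Hxa] Hy. simpl. exists (RInt f x y).
      split; [apply (RInt_correct (V := R_CompleteNormedModule)), Hex; [exact Hx|lra]|].
      apply HP.
      assert (H1 : RInt f x y = RInt f x a1 + RInt f a1 b1 + RInt f b1 y).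
      { rewrite <- (RInt_Chasles f x b1 y), <- (RInt_Chasles f x a1 b1).
        - reflexivity.
        - now apply Hex.
        - now apply Hex.
        - apply Hex; [exact Hx|lra].
        - apply (ex_RInt_Chasles_2 (V := R_CompleteNormedModule)) with x; [lra|]. apply Hex; [exact Hx|lra]. }
      assert (H2 : 0 <= RInt f x a1).
      { apply RInt_ge_0; [lra|now apply Hex|]. intros t Ht. apply (Hpos x); [exact Hx|lra]. }
      assert (H3 : 0 <= RInt f b1 y).
      { apply RInt_ge_0; [lra| |].
        - apply (ex_RInt_Chasles_2 (V := R_CompleteNormedModule)) with x; [lra|]. apply Hex; [exact Hx|lra].
        - intros t Ht. apply (Hpos x); [exact Hx|lra]. }
      assert (H4 : RInt f x y <= l) by (apply Hle; [exact Hx|lra]).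
      apply Rabs_def1; unfold minus, plus, opp; simpl; destruct eps as [e He]; simpl in *; lra.
Qed.

(** The fundamental theorem of calculus with limits at both ends. Derivative and continuity are
    asked only to the right of points that [Fa] sees, since real powers are differentiable on
    positive numbers only; [a0] separates the two ends. *)
Lemma is_RInt_gen_antiderivative (Fa Fb : (R -> Prop) -> Prop) (FFa : Filter Fa) (FFb : Filter Fb)
    (a0 : R) (F f : R -> R) (la lb : R) :
  Fa (fun x => x <= a0) -> Fb (fun y => a0 <= y) ->
  Fa (fun x => forall t, x <= t -> is_derive F t (f t)) ->
  Fa (fun x => forall t, x <= t -> continuous f t) ->
  filterlim F Fa (locally la) -> filterlim F Fb (locally lb) ->
  is_RInt_gen f Fa Fb (lb - la).
Proof.
  intros H1 H2 H3 H4 Hla Hlb P HP.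
  assert (Hlim : filterlim (fun ab => F (snd ab) - F (fst ab)) (filter_prod Fa Fb) (locally (lb - la))).
  { unfold Rminus.
    apply (filterlim_comp_2 (F := filter_prod Fa Fb) (G := locally lb) (H := locally (- la))
             (fun ab => F (snd ab)) (fun ab => - F (fst ab)) Rplus).
    - apply (filterlim_comp _ _ _ snd F _ Fb); [apply filterlim_snd|exact Hlb].
    - apply (filterlim_comp _ _ _ (fun ab => F (fst ab)) Ropp _ (locally la)).
      + apply (filterlim_comp _ _ _ fst F _ Fa); [apply filterlim_fst|exact Hla].
      + apply (filterlim_opp la).
    - apply (filterlim_plus (V := R_NormedModule) lb (- la)). }
  specialize (Hlim P HP).
  assert (HQ : filter_prod Fa Fb (fun ab => (fst ab <= snd ab) /\
      (forall t, fst ab <= t -> is_derive F t (f t)) /\ (forall t, fst ab <= t -> continuous f t))).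
  { apply Filter_prod with (fun x => x <= a0 /\ (forall t, x <= t -> is_derive F t (f t)) /\
      (forall t, x <= t -> continuous f t)) (fun y => a0 <= y).
    - repeat apply filter_and; assumption.
    - exact H2.
    - simpl. intros x y (Hx & Hd & Hc) Hy. split; [lra|]. now split. }
  unfold filtermap in Hlim. unfold filtermapi. generalize (filter_and _ _ Hlim HQ). apply filter_imp.
  intros [x y] (HPx & Hxy & Hd & Hc). simpl in *.
  exists (F y - F x). split; [|exact HPx].
  apply (is_RInt_derive F f); rewrite Rmin_left by exact Hxy; intros t Ht; [apply Hd|apply Hc]; lra.
Qed.

Lemma exp_le_mono (x y : R) : x <= y -> exp x <= exp y.
Proof.
  intros [H | ->]; [apply Rlt_le, exp_increasing, H|apply Rle_refl].
Qed.

Lemma at_right_0_domain (a : R) : 0 < a -> at_right 0 (fun x => 0 < x /\ x <= a).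
Proof.
  intros Ha. exists (mkposreal a Ha). intros x Hx Hx0. split; [exact Hx0|].
  apply Rabs_def2 in Hx. unfold minus, plus, opp in Hx. simpl in Hx. lra.
Qed.

Lemma Rbar_locally_p_infty_ge (a : R) : Rbar_locally p_infty (fun x => a <= x).
Proof. exists a. intros x Hx. lra. Qed.

Lemma Rpower_derive (r t : R) : 0 < t -> is_derive (fun x => Rpower x r) t (r * Rpower t (r - 1)).
Proof.
  intros Ht. apply is_derive_Reals. now apply derivable_pt_lim_power.
Qed.

Lemma Rpower_continuous (r t : R) : 0 < t -> continuous (fun x => Rpower x r) t.
Proof.
  intros Ht. apply (ex_derive_continuous (V := R_NormedModule)).
  eexists. now apply Rpower_derive.
Qed.

Lemma Rpower_pos (x r : R) : 0 < Rpower x r.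
Proof. apply exp_pos. Qed.

(** With [u = t / (2 * (r + 1))], the inequality [ln u <= u] bounds [r * ln t] by a constant plus
    [r * u], and [r * u <= t / 2]. This dominates the Gamma integrand and also the boundary term at
    infinity in [Gamma_succ]. *)
Lemma Rpower_exp_neg_le (r : R) : 0 <= r ->
  exists K, 0 < K /\ forall t, 0 < t -> Rpower t r * exp (- t) <= K * exp (- (t / 2)).
Proof.
  intros Hr. exists (exp (r * ln (2 * (r + 1)))). split; [apply exp_pos|].
  intros t Ht. unfold Rpower. rewrite <- !exp_plus. apply exp_le_mono.
  set (u := t / (2 * (r + 1))).
  assert (Hu : 0 < u) by (apply Rdiv_lt_0_compat; lra).
  assert (Hln : ln u <= u).
  { rewrite <- (ln_exp u) at 2. apply ln_le; [exact Hu|].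
    generalize (exp_ineq1_le u). lra. }
  assert (Ht' : t = 2 * (r + 1) * u) by (unfold u; field; lra).
  rewrite Ht'. rewrite ln_mult by lra.
  nra.
Qed.

Lemma Gamma_integrand_continuous (s t : R) : 0 < t ->
  continuous (fun t => Rpower t (s - 1) * exp (- t)) t.
Proof.
  intros Ht. apply (continuous_mult (fun t => Rpower t (s - 1)) (fun t => exp (- t))).
  - now apply Rpower_continuous.
  - apply (continuous_comp (fun x => - x) exp).
    + apply (continuous_opp (V := R_NormedModule)), continuous_id.
    + apply continuous_exp.
Qed.

Lemma ex_RInt_Gamma (s a b : R) : 0 < a -> a <= b ->
  ex_RInt (fun t => Rpower t (s - 1) * exp (- t)) a b.
Proof.
  intros Ha Hab. apply (ex_RInt_continuous (V := R_CompleteNormedModule)).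
  rewrite Rmin_left by exact Hab. intros z Hz. apply Gamma_integrand_continuous. lra.
Qed.

Lemma Gamma_correct (s : R) : 1 <= s ->
  is_RInt_gen (fun t => Rpower t (s - 1) * exp (- t)) (at_right 0) (Rbar_locally p_infty) (Gamma s)
  /\ 0 < Gamma s.
Proof.
  intros Hs.
  destruct (Rpower_exp_neg_le (s - 1)) as [K [HK HKle]]; [lra|].
  destruct (RInt_gen_nonneg_bounded (at_right 0) _ (fun a => 0 < a)
      (fun t => Rpower t (s - 1) * exp (- t)) 1 (2 * K)) as [l [Hl Hle]].
  - lra.
  - apply at_right_0_domain.
  - apply ex_RInt_Gamma.
  - intros a t _ _. apply Rlt_le, Rmult_lt_0_compat; apply exp_pos.
  - intros a b Ha Hab.
    assert (HI : is_RInt (fun t => K * exp (- (t / 2))) a b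
        ((- 2 * K * exp (- (b / 2))) - (- 2 * K * exp (- (a / 2))))).
    { apply (is_RInt_derive (fun t => - 2 * K * exp (- (t / 2)))).
      - intros x _. auto_derive; [exact I|]. unfold Rdiv. field.
      - intros x _. apply (ex_derive_continuous (V := R_NormedModule)). auto_derive. exact I. }
    apply Rle_trans with (RInt (fun t => K * exp (- (t / 2))) a b).
    + apply RInt_le; [exact Hab|now apply ex_RInt_Gamma|eexists; exact HI|].
      intros t Ht. apply HKle. lra.
    + rewrite (is_RInt_unique _ _ _ _ HI).
      assert (exp (- (a / 2)) <= 1).
      { rewrite <- exp_0. apply exp_le_mono. lra. }
      generalize (exp_pos (- (b / 2))). intros. nra.
  - assert (HG : Gamma s = l) by exact (is_RInt_gen_unique (V := R_CompleteNormedModule) _ _ Hl).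
    rewrite HG. split; [exact Hl|].
    (* Positivity: the integral over [[1, 2]] of a positive continuous function is already
       positive. *)
    apply Rlt_le_trans with (RInt (fun t => Rpower t (s - 1) * exp (- t)) 1 2).
    + apply RInt_gt_0; [lra| |].
      * intros x Hx. apply Rmult_lt_0_compat; apply exp_pos.
      * intros x Hx. apply Gamma_integrand_continuous. lra.
    + apply Hle; lra.
Qed.

Lemma exp_neg_lim (k : R) : 0 < k -> is_lim (fun t => exp (- (k * t))) p_infty 0.
Proof.
  intros Hk. apply is_lim_comp with m_infty.
  - apply is_lim_exp_m.
  - replace m_infty with (Rbar_opp p_infty) by reflexivity.
    apply is_lim_opp.
    replace p_infty with (Rbar_mult k p_infty) at 2.
    + apply is_lim_scal_l, is_lim_id.
    + simpl. destruct (Rle_dec 0 k) as [h|h]; [|exfalso; lra].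
      destruct (Rle_lt_or_eq_dec 0 k h); [reflexivity|exfalso; lra].
  - exists 0. intros. discriminate.
Qed.

Lemma Gamma_1 : Gamma 1 = 1.
Proof.
  unfold Gamma. apply (is_RInt_gen_unique (V := R_CompleteNormedModule)).
  apply (is_RInt_gen_ext (fun t => exp (- t))).
  - apply Filter_prod with (fun x => 0 < x /\ x <= 1) (fun y => 1 <= y).
    + apply at_right_0_domain. lra.
    + apply Rbar_locally_p_infty_ge.
    + intros x y Hx Hy. simpl. rewrite Rmin_left by lra. intros t Ht.
      replace (1 - 1) with 0 by ring. rewrite Rpower_O by lra. ring.
  - assert (H1 : 0 - (- exp (- 0)) = 1) by (rewrite Ropp_0, exp_0; ring). rewrite <- H1.
    apply (is_RInt_gen_antiderivative (at_right 0) (Rbar_locally p_infty) _ _ 1 (fun t => - exp (- t))).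
    + apply filter_imp with (fun x => 0 < x /\ x <= 1); [tauto|]. apply at_right_0_domain. lra.
    + apply Rbar_locally_p_infty_ge.
    + apply filter_forall. intros x t _. auto_derive; [exact I|ring].
    + apply filter_forall. intros x t _. apply (ex_derive_continuous (V := R_NormedModule)).
      auto_derive. exact I.
    + apply (filterlim_filter_le_1 (F := locally 0) (G := at_right 0)); [apply filter_le_within|].
      apply (ex_derive_continuous (V := R_NormedModule) (fun t => - exp (- t))). auto_derive. exact I.
    + change (is_lim (fun t => - exp (- t)) p_infty 0).
      replace (Finite 0) with (Rbar_opp 0) by (simpl; f_equal; ring).
      apply is_lim_opp. apply is_lim_ext with (fun t => exp (- (1 * t))).
      * intros t. f_equal. ring.
      * apply exp_neg_lim. lra.
Qed.

Lemma Gamma_succ (s : R) : 1 <= s -> Gamma (s + 1) = s * Gamma s.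
Proof.
  intros Hs.
  destruct (Gamma_correct s Hs) as [H1 _].
  destruct (Gamma_correct (s + 1)) as [H2 _]; [lra|].
  (* Integration by parts: the integrand is the derivative of [t^s * exp (- t)], which vanishes at
     both ends. *)
  assert (H3 : is_RInt_gen (fun t => s * (Rpower t (s - 1) * exp (- t)) - Rpower t (s + 1 - 1) * exp (- t))
      (at_right 0) (Rbar_locally p_infty) (0 - 0)).
  { apply (is_RInt_gen_antiderivative (at_right 0) (Rbar_locally p_infty) _ _ 1 (fun t => Rpower t s * exp (- t))).
    - apply filter_imp with (fun x => 0 < x /\ x <= 1); [tauto|]. apply at_right_0_domain. lra.
    - apply Rbar_locally_p_infty_ge.
    - apply filter_imp with (fun x => 0 < x /\ x <= 1); [|apply at_right_0_domain; lra].
      intros x [Hx _] t Ht.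
      replace (s * (Rpower t (s - 1) * exp (- t)) - Rpower t (s + 1 - 1) * exp (- t))
        with ((s * Rpower t (s - 1)) * exp (- t) + Rpower t s * (- exp (- t)))
        by (replace (s + 1 - 1) with s by ring; ring).
      apply (is_derive_mult (fun t => Rpower t s) (fun t => exp (- t))).
      + apply Rpower_derive. lra.
      + auto_derive; [exact I|ring].
      + apply Rmult_comm.
    - apply filter_imp with (fun x => 0 < x /\ x <= 1); [|apply at_right_0_domain; lra].
      intros x [Hx _] t Ht.
      apply (continuous_minus (V := R_NormedModule) (fun t => s * (Rpower t (s - 1) * exp (- t)))
        (fun t => Rpower t (s + 1 - 1) * exp (- t))).
      + apply (continuous_scal_r (V := R_NormedModule) s). apply Gamma_integrand_continuous. lra.
      + apply Gamma_integrand_continuous. lra.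
    (* Near 0 the boundary term lies between 0 and [t], because [s >= 1] and [t <= 1]. *)
    - apply (filterlim_le_le (F := at_right 0) (fun _ => 0) _ (fun t => t) 0).
      + apply filter_imp with (fun x => 0 < x /\ x <= 1); [|apply at_right_0_domain; lra].
        intros t Ht. split.
        * apply Rlt_le, Rmult_lt_0_compat; apply exp_pos.
        * assert (Rpower t s <= t).
          { rewrite <- (exp_ln t) at 2 by lra. apply exp_le_mono.
            assert (ln t <= 0) by (rewrite <- ln_1; apply ln_le; lra). nra. }
          assert (exp (- t) <= 1) by (rewrite <- exp_0; apply exp_le_mono; lra).
          generalize (exp_pos (- t)) (Rpower_pos t s). intros. nra.
      + apply filterlim_const.
      + apply (filterlim_filter_le_1 (F := locally 0) (G := at_right 0)); [apply filter_le_within|apply filterlim_id].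
    - destruct (Rpower_exp_neg_le s) as [K [HK HKle]]; [lra|].
      apply (filterlim_le_le (F := Rbar_locally p_infty) (fun _ => 0) _ (fun t => K * exp (- (/ 2 * t))) 0).
      + exists 0. intros t Ht. split.
        * apply Rlt_le, Rmult_lt_0_compat; apply exp_pos.
        * replace (/ 2 * t) with (t / 2) by field. now apply HKle.
      + apply filterlim_const.
      + change (is_lim (fun t => K * exp (- (/ 2 * t))) p_infty 0).
        replace (Finite 0) with (Rbar_mult K 0) by (simpl; f_equal; ring).
        apply is_lim_scal_l, exp_neg_lim. lra. }
  assert (H4 := is_RInt_gen_minus _ _ _ _ (is_RInt_gen_scal _ s _ H1) H2).
  assert (H5 := is_RInt_gen_unique (V := R_CompleteNormedModule) _ _ H3).
  assert (H6 := is_RInt_gen_unique (V := R_CompleteNormedModule) _ _ H4).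
  unfold minus, scal, plus, opp in H6; simpl in H6; unfold mult in H6; simpl in H6.
  unfold Rminus in H5 at 1. rewrite H5 in H6. lra.
Qed.

(** * Jain weights *)

(** Abel polynomials divided by [v!]. The case [v = 0] is separate because [y * y^(-1)] stands for 1
    there, whereas the truncated subtraction in [omega] would give [y]; this makes the weight with
    index 0 the factor [exp (- n x)] of [f 0]. *)
Definition abel (beta : R) (v : nat) (y : R) : R :=
  match v with
  | O => 1
  | S k => y * (y + INR v * beta) ^ k / INR (fact v)
  end.

Definition jain (beta : R) (v : nat) (y : R) : R :=
  abel beta v y * exp (- (y + INR v * beta)).

(** The companion family to which moments reduce: a factor [v] in front of [jain] cancels against
    the factorial and leaves a term of this family at [y + beta]. Its sum over [v] is
    [1 / (1 - beta)] by Jensen's identity; the upper bound is proved in [sum_borel_le]. *)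
Definition borel (beta : R) (v : nat) (y : R) : R :=
  (y + INR v * beta) ^ v / INR (fact v) * exp (- (y + INR v * beta)).

Lemma jain_S (beta : R) (k : nat) (y : R) : jain beta (S k) y = omega beta (S k) y.
Proof.
  unfold jain, abel, omega. replace (S k - 1)%nat with k by lia. unfold Rdiv. ring.
Qed.

Lemma jain_0 (beta y : R) : jain beta 0 y = exp (- y).
Proof.
  unfold jain, abel. rewrite Rmult_1_l. f_equal. simpl. ring.
Qed.

Lemma INR_fact_S (k : nat) : INR (fact (S k)) = INR (S k) * INR (fact k).
Proof. rewrite <- mult_INR. reflexivity. Qed.

Lemma jain_nonneg (beta : R) (v : nat) (y : R) : 0 <= beta -> 0 <= y -> 0 <= jain beta v y.
Proof.
  intros Hb Hy. unfold jain. apply Rmult_le_pos; [|apply Rlt_le, exp_pos].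
  unfold abel. destruct v as [|k]; [lra|].
  apply Rmult_le_pos; [apply Rmult_le_pos; [exact Hy|]|].
  - apply pow_le. generalize (pos_INR (S k)). nra.
  - apply Rlt_le, Rinv_0_lt_compat, INR_fact_lt_0.
Qed.

Lemma borel_nonneg (beta : R) (v : nat) (y : R) : 0 <= beta -> 0 <= y -> 0 <= borel beta v y.
Proof.
  intros Hb Hy. unfold borel. apply Rmult_le_pos; [|apply Rlt_le, exp_pos].
  apply Rmult_le_pos.
  - apply pow_le. generalize (pos_INR v). nra.
  - apply Rlt_le, Rinv_0_lt_compat, INR_fact_lt_0.
Qed.

Lemma borel_0 (beta y : R) : borel beta 0 y = jain beta 0 y.
Proof. unfold borel, jain, abel. simpl. field. Qed.

(** One factor [y + (k + 1) beta] of the power is split: the part [y] yields the Jain weight, and in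
    the part [(k + 1) beta] the number [k + 1] cancels against the factorial. *)
Lemma borel_S (beta : R) (k : nat) (y : R) :
  borel beta (S k) y = jain beta (S k) y + beta * borel beta k (y + beta).
Proof.
  unfold borel, jain, abel. rewrite INR_fact_S.
  replace (y + beta + INR k * beta) with (y + INR (S k) * beta) by (rewrite S_INR; ring).
  rewrite <- tech_pow_Rmult.
  field. split; [apply INR_fact_neq_0|]. apply not_0_INR. lia.
Qed.

Lemma mult_jain_S (beta : R) (k : nat) (y : R) :
  INR (S k) * jain beta (S k) y = y * borel beta k (y + beta).
Proof.
  unfold borel, jain, abel. rewrite INR_fact_S.
  replace (y + beta + INR k * beta) with (y + INR (S k) * beta) by (rewrite S_INR; ring).
  field. split; [apply INR_fact_neq_0|]. apply not_0_INR. lia.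
Qed.

Lemma mult_borel_S (beta : R) (k : nat) (y : R) :
  INR (S k) * borel beta (S k) y
  = (y + beta) * borel beta k (y + beta) + beta * (INR k * borel beta k (y + beta)).
Proof.
  unfold borel. rewrite INR_fact_S.
  replace (y + beta + INR k * beta) with (y + INR (S k) * beta) by (rewrite S_INR; ring).
  rewrite <- tech_pow_Rmult.
  assert (H : INR (S k) * beta = beta + INR k * beta) by (rewrite S_INR; ring).
  replace ((y + INR (S k) * beta) * (y + INR (S k) * beta) ^ k)
    with ((y + beta + INR k * beta) * (y + INR (S k) * beta) ^ k)
    by (rewrite (Rplus_assoc y beta), <- H; reflexivity).
  field. split; [apply INR_fact_neq_0|]. apply not_0_INR. lia.
Qed.

(** * The Abel expansion of the exponential *)

Lemma sum_f_R0_shift (u : nat -> R) (N : nat) :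
  sum_f_R0 u (S N) = u 0%nat + sum_f_R0 (fun k => u (S k)) N.
Proof.
  induction N as [|N IH]; [reflexivity|]. rewrite tech5, IH, tech5. ring.
Qed.

(** Differentiation lowers the index and shifts the argument, as for every Abel sequence. In the
    product rule the linear factors combine to [(k + 2) (y + beta)], and [k + 2] cancels against the
    factorial. *)
Lemma abel_derive (beta : R) (k : nat) (y : R) :
  is_derive (fun y => abel beta (S k) y) y (abel beta k (y + beta)).
Proof.
  unfold abel. destruct k as [|k].
  - auto_derive; [exact I|]. simpl. field.
  - assert (H : forall z d, is_derive (fun y => y * (y + z) ^ S k / d) y
        ((y + z) ^ k * (y + z + INR (S k) * y) / d)).
    { intros z d. auto_derive; [exact I|]. unfold Rdiv. simpl (INR (S k)). ring. }
    replace ((y + beta) * (y + beta + INR (S k) * beta) ^ k / INR (fact (S k)))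
      with ((y + INR (S (S k)) * beta) ^ k
        * (y + INR (S (S k)) * beta + INR (S k) * y) / INR (fact (S (S k)))); [apply H|].
    rewrite (INR_fact_S (S k)).
    replace (y + beta + INR (S k) * beta) with (y + INR (S (S k)) * beta)
      by (rewrite (S_INR (S k)); ring).
    set (z := (y + INR (S (S k)) * beta) ^ k).
    rewrite (S_INR (S k)). field.
    split; [apply INR_fact_neq_0|]. generalize (pos_INR (S k)). lra.
Qed.

Definition abel_sum (beta : R) (N : nat) (y : R) : R :=
  sum_f_R0 (fun v => abel beta v y * exp (- (INR v * beta))) N.

Lemma abel_sum_derive (beta : R) (N : nat) (y : R) :
  is_derive (fun y => abel_sum beta (S N) y) y (exp (- beta) * abel_sum beta N (y + beta)).
Proof.
  assert (Hterm : forall k, is_derive (fun y => abel beta (S k) y * exp (- (INR (S k) * beta))) y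
      (exp (- beta) * (abel beta k (y + beta) * exp (- (INR k * beta))))).
  { intros k.
    replace (exp (- beta) * (abel beta k (y + beta) * exp (- (INR k * beta))))
      with (exp (- (INR (S k) * beta)) * abel beta k (y + beta)).
    - apply (is_derive_ext (fun y => exp (- (INR (S k) * beta)) * abel beta (S k) y)).
      + intros t. apply Rmult_comm.
      + apply (is_derive_scal (fun y => abel beta (S k) y)), abel_derive.
    - replace (- (INR (S k) * beta)) with (- beta + - (INR k * beta)) by (rewrite S_INR; ring).
      rewrite exp_plus. ring. }
  unfold abel_sum. induction N as [|N IH].
  - apply (is_derive_ext (fun y => 1 + abel beta 1 y * exp (- (INR 1 * beta)))).
    + intros t. simpl. rewrite Rmult_0_l, Ropp_0, exp_0. ring.
    + replace (exp (- beta) * _) with (0 + exp (- beta) *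
        (abel beta 0 (y + beta) * exp (- (INR 0 * beta)))) by (simpl; ring).
      apply (is_derive_plus (fun _ => 1)); [|apply Hterm].
      apply (is_derive_const (V := R_NormedModule) 1).
  - rewrite (tech5 _ N), Rmult_plus_distr_l.
    apply (is_derive_ext (fun y =>
      sum_f_R0 (fun v => abel beta v y * exp (- (INR v * beta))) (S N)
      + abel beta (S (S N)) y * exp (- (INR (S (S N)) * beta)))).
    + intros t. now rewrite (tech5 _ (S N)).
    + apply (is_derive_plus _ (fun y => abel beta (S (S N)) y * exp (- (INR (S (S N)) * beta))));
        [exact IH|apply Hterm].
Qed.

Lemma nonneg_of_derive (F f : R -> R) (y : R) :
  0 <= y -> 0 <= F 0 ->
  (forall t, 0 <= t -> is_derive F t (f t)) -> (forall t, 0 <= t -> 0 <= f t) -> 0 <= F y.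
Proof.
  intros [Hy|<-] H0 HF Hf; [|exact H0].
  destruct (MVT_cor2 F f 0 y Hy) as (t & Ht & Ht1 & Ht2).
  - intros t [Ht _]. now apply is_derive_Reals, HF.
  - assert (0 <= f t) by (apply Hf; lra). nra.
Qed.

(* The remainder [r_N] of the Abel expansion of [exp] satisfies
   [r_(N+1)'(y) = exp (- beta) * r_N (y + beta)], so both bounds propagate by integration;
   the rate [2] in [exp (2 * y)] makes the ratio [exp beta / 2] smaller than 1. *)
Lemma abel_sum_remainder (beta : R) (N : nat) (y : R) : 0 <= beta -> 0 <= y ->
  0 <= exp y - abel_sum beta N y <= (exp beta / 2) ^ N * exp (2 * y).
Proof.
  intros Hb. revert y. induction N as [|N IH]; intros y Hy.
  - unfold abel_sum. simpl. rewrite Rmult_0_l, Ropp_0, exp_0.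
    assert (1 <= exp y) by (rewrite <- exp_0; now apply exp_le_mono).
    replace (2 * y) with (y + y) by ring. rewrite exp_plus. nra.
  - assert (Hr0 : abel_sum beta (S N) 0 = 1).
    { unfold abel_sum. rewrite sum_f_R0_shift.
      rewrite (sum_eq _ (fun _ => 0)).
      - rewrite sum_cte. simpl. rewrite Rmult_0_l, Ropp_0, exp_0. ring.
      - intros i _. unfold abel, Rdiv. rewrite !Rmult_0_l. reflexivity. }
    assert (Hd : forall t, is_derive (fun y => exp y - abel_sum beta (S N) y) t
        (exp (- beta) * (exp (t + beta) - abel_sum beta N (t + beta)))).
    { intros t. replace (exp (- beta) * _) with
        (exp t - exp (- beta) * abel_sum beta N (t + beta)).
      - apply (is_derive_minus exp (fun y => abel_sum beta (S N) y)).
        + apply is_derive_exp.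
        + apply abel_sum_derive.
      - rewrite exp_plus, exp_Ropp. field. apply Rgt_not_eq, exp_pos. }
    split.
    + apply (nonneg_of_derive _ _ y Hy) with (2 := fun t _ => Hd t).
      * rewrite Hr0, exp_0. lra.
      * intros t Ht. apply Rmult_le_pos; [apply Rlt_le, exp_pos|]. apply IH. lra.
    + set (q := exp beta / 2).
      assert (Hq : 0 < q) by (unfold q; generalize (exp_pos beta); lra).
      apply Rminus_le_0.
      apply (nonneg_of_derive (fun y => q ^ S N * exp (2 * y) - (exp y - abel_sum beta (S N) y))
        (fun t => 2 * (q ^ S N * exp (2 * t))
           - exp (- beta) * (exp (t + beta) - abel_sum beta N (t + beta))) y Hy).
      * rewrite Hr0, exp_0. generalize (pow_lt q (S N) Hq) (exp_pos (2 * 0)). nra.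
      * intros t _.
        apply (is_derive_minus (fun y => q ^ S N * exp (2 * y))
          (fun y => exp y - abel_sum beta (S N) y)); [|apply Hd].
        generalize (q ^ S N). intros w. auto_derive; [exact I|ring].
      * intros t Ht. destruct (IH (t + beta)) as [_ H]; [lra|].
        apply Rmult_le_compat_l with (r := exp (- beta)) in H; [|apply Rlt_le, exp_pos].
        fold q in H.
        (* The shift turns [exp (2 * t)] into [exp (2 * t) * exp (2 * beta)]; together with
           [exp (- beta)] this leaves one factor [exp beta = 2 * q], so the bound on the derivative
           is the derivative of the next bound. *)
        assert (Hx : exp (- beta) * (q ^ N * exp (2 * (t + beta))) = 2 * (q ^ S N * exp (2 * t))).
        { rewrite <- tech_pow_Rmult. unfold q at 2.
          replace (2 * (t + beta)) with (2 * t + beta + beta) by ring.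
          rewrite !exp_plus, exp_Ropp. field. apply Rgt_not_eq, exp_pos. }
        lra.
Qed.

Lemma sum_jain (beta : R) (N : nat) (y : R) :
  sum_f_R0 (fun v => jain beta v y) N = exp (- y) * abel_sum beta N y.
Proof.
  unfold abel_sum. rewrite scal_sum. apply sum_eq. intros v _. unfold jain.
  rewrite Ropp_plus_distr, exp_plus. ring.
Qed.

Lemma is_series_jain (beta y : R) : 0 <= beta <= / 2 -> 0 <= y ->
  is_series (fun v => jain beta v y) 1.
Proof.
  intros Hb Hy.
  (* The square of [exp (/ 2)] is at most 3, hence [exp (/ 2) < 2]. This is the origin of the range
     [beta <= / 2]. *)
  assert (Hq : Rabs (exp beta / 2) < 1).
  { rewrite Rabs_pos_eq by (generalize (exp_pos beta); lra).
    assert (exp beta <= exp (/ 2)) by (apply exp_le_mono; lra).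
    assert (exp (/ 2) * exp (/ 2) <= 3).
    { rewrite <- exp_plus. replace (/ 2 + / 2) with 1 by field. apply exp_le_3. }
    generalize (exp_pos (/ 2)). nra. }
  change (is_lim_seq (sum_n (fun v => jain beta v y)) 1).
  apply (is_lim_seq_ext (fun N => sum_f_R0 (fun v => jain beta v y) N)).
  { intros N. symmetry. apply sum_n_Reals. }
  apply (is_lim_seq_le_le (fun N => 1 - (exp beta / 2) ^ N * exp y) _ (fun _ => 1)).
  - intros N. rewrite sum_jain. destruct (abel_sum_remainder beta N y) as [H1 H2]; [lra|exact Hy|].
    assert (He : exp (- y) * exp y = 1) by (rewrite <- exp_plus, Rplus_opp_l; apply exp_0).
    assert (H2y : exp (2 * y) = exp y * exp y) by (rewrite <- exp_plus; f_equal; ring).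
    rewrite H2y in H2.
    assert (H3 := exp_pos (- y)). split.
    + apply Rmult_le_compat_l with (r := exp (- y)) in H2; [|lra].
      replace (exp (- y) * ((exp beta / 2) ^ N * (exp y * exp y))) with
        ((exp (- y) * exp y) * ((exp beta / 2) ^ N * exp y)) in H2 by ring.
      rewrite He in H2. lra.
    + nra.
  - replace (Finite 1) with (Finite (1 - 0 * exp y)) by (f_equal; ring).
    apply is_lim_seq_minus'; [apply is_lim_seq_const|].
    apply is_lim_seq_mult'; [now apply is_lim_seq_geom|apply is_lim_seq_const].
  - apply is_lim_seq_const.
Qed.

(** * Bounds for the moments of the Jain weights *)

Lemma sum_le_series (a : nat -> R) (l : R) (N : nat) :
  (forall n, 0 <= a n) -> is_series a l -> sum_f_R0 a N <= l.
Proof.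
  intros Ha Hl. rewrite <- sum_n_Reals.
  apply (is_lim_seq_incr_compare (sum_n a) l Hl).
  intros n. rewrite sum_Sn. unfold plus. simpl. generalize (Ha (S n)). lra.
Qed.

Lemma ex_series_nonneg_bounded (a : nat -> R) (M : R) :
  (forall n, 0 <= a n) -> (forall N, sum_f_R0 a N <= M) -> ex_series a /\ Series a <= M.
Proof.
  intros Ha HM.
  assert (Hex : ex_series a).
  { destruct (ex_finite_lim_seq_incr (sum_n a) M) as [l Hl].
    - intros n. rewrite sum_Sn. unfold plus. simpl. generalize (Ha (S n)). lra.
    - intros n. rewrite sum_n_Reals. apply HM.
    - now exists l. }
  split; [exact Hex|].
  assert (Hl := Series_correct _ Hex).
  apply (is_lim_seq_le (sum_n a) (fun _ => M) (Series a) M).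
  - intros n. rewrite sum_n_Reals. apply HM.
  - exact Hl.
  - apply is_lim_seq_const.
Qed.

(** By [borel_S] and total mass 1 of the Jain weights, a bound [B] for [N] terms, valid for all [y],
    gives [1 + beta * B] for [N + 1] terms. The fixed point of this map is [1 / (1 - beta)]. *)
Lemma sum_borel_le (beta y : R) (N : nat) : 0 <= beta <= / 2 -> 0 <= y ->
  sum_f_R0 (fun v => borel beta v y) N <= / (1 - beta).
Proof.
  intros Hb. revert y. induction N as [|N IH]; intros y Hy.
  - simpl. rewrite borel_0, jain_0.
    assert (exp (- y) <= 1) by (rewrite <- exp_0; apply exp_le_mono; lra).
    assert (1 <= / (1 - beta)) by (rewrite <- Rinv_1 at 1; apply Rinv_le_contravar; lra).
    lra.
  - rewrite sum_f_R0_shift, borel_0.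
    rewrite (sum_eq _ (fun k => jain beta (S k) y + beta * borel beta k (y + beta)))
      by (intros; apply borel_S).
    rewrite sum_plus, <- Rplus_assoc, <- (sum_f_R0_shift (fun v => jain beta v y)).
    rewrite (sum_eq (fun k => beta * _) (fun k => borel beta k (y + beta) * beta))
      by (intros; apply Rmult_comm).
    rewrite <- scal_sum.
    assert (H1 := sum_le_series (fun v => jain beta v y) 1 (S N)
      (fun v => jain_nonneg beta v y (proj1 Hb) Hy) (is_series_jain beta y Hb Hy)).
    assert (H2 : sum_f_R0 (fun v => borel beta v (y + beta)) N <= / (1 - beta)) by (apply IH; lra).
    apply Rle_trans with (1 + beta * / (1 - beta)).
    + apply Rplus_le_compat; [exact H1|]. apply Rmult_le_compat_l; [lra|exact H2].
    + right. field. lra.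
Qed.

(** The right-hand side is the affine solution of [G y = (y + beta) / (1 - beta) + beta * G (y +
    beta)], the recursion that [mult_borel_S] produces; the induction step therefore closes with an
    equality. *)
Lemma sum_mult_borel_le (beta y : R) (N : nat) : 0 <= beta <= / 2 -> 0 <= y ->
  sum_f_R0 (fun v => INR v * borel beta v y) N <= y / (1 - beta) ^ 2 + beta / (1 - beta) ^ 3.
Proof.
  intros Hb. revert y. induction N as [|N IH]; intros y Hy.
  - simpl. rewrite Rmult_0_l. apply Rplus_le_le_0_compat.
    + apply Rdiv_le_0_compat; [exact Hy|]. apply (pow_lt (1 - beta) 2). lra.
    + apply Rdiv_le_0_compat; [lra|]. apply (pow_lt (1 - beta) 3). lra.
  - rewrite sum_f_R0_shift.
    rewrite (sum_eq _ (fun k => borel beta k (y + beta) * (y + beta)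
       + (INR k * borel beta k (y + beta)) * beta))
      by (intros; rewrite mult_borel_S; ring).
    rewrite sum_plus, <- !scal_sum.
    assert (H1 : sum_f_R0 (fun v => borel beta v (y + beta)) N <= / (1 - beta))
      by (apply sum_borel_le; [exact Hb|lra]).
    assert (H2 := IH (y + beta) ltac:(lra)).
    apply Rle_trans with (0 * borel beta 0 y + ((y + beta) * / (1 - beta)
      + beta * ((y + beta) / (1 - beta) ^ 2 + beta / (1 - beta) ^ 3))).
    + apply Rplus_le_compat; [right; reflexivity|]. apply Rplus_le_compat; apply Rmult_le_compat_l; lra.
    + right. field. lra.
Qed.

(** Up to the factor [y] the moment is the sum of [borel] at [y + beta], which dominates term by
    term the Jain weights there, of sum 1. *)
Lemma jain_first_moment (beta y : R) : 0 <= beta <= / 2 -> 0 <= y ->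
  ex_series (fun v => INR v * jain beta v y) /\ y <= Series (fun v => INR v * jain beta v y).
Proof.
  intros Hb Hy.
  assert (Hpos : forall n, 0 <= borel beta n (y + beta)) by (intros; apply borel_nonneg; lra).
  destruct (ex_series_nonneg_bounded _ _ Hpos
    (fun N => sum_borel_le beta (y + beta) N Hb ltac:(lra))) as [Hex _].
  assert (Hex1 : ex_series (fun v => INR v * jain beta v y)).
  { apply ex_series_incr_1.
    apply (ex_series_ext (fun k => y * borel beta k (y + beta))).
    - intros k. symmetry. apply mult_jain_S.
    - now apply (ex_series_scal_l (V := R_NormedModule) y). }
  split; [exact Hex1|].
  rewrite Series_incr_1 by exact Hex1. rewrite Rmult_0_l, Rplus_0_l.
  rewrite (Series_ext _ _ (fun k => mult_jain_S beta k y)), Series_scal_l.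
  assert (1 <= Series (fun k => borel beta k (y + beta))).
  { rewrite <- (is_series_unique _ _ (is_series_jain beta (y + beta) Hb ltac:(lra))).
    apply Series_le; [|exact Hex]. intros [|n].
    - rewrite borel_0. split; [apply jain_nonneg; lra|lra].
    - rewrite borel_S. split; [apply jain_nonneg; lra|].
      assert (0 <= borel beta n (y + beta + beta)) by (apply borel_nonneg; lra). nra. }
  nra.
Qed.

(** The weight [v (v + 1)] is the numerator in the second moment of the Baskakov density of index
    [v]. *)
Lemma jain_second_moment (beta y : R) : 0 <= beta <= / 2 -> 0 <= y ->
  ex_series (fun v => INR v * (INR v + 1) * jain beta v y) /\
  Series (fun v => INR v * (INR v + 1) * jain beta v y) <= y ^ 2 / (1 - beta) ^ 2 + 10 * y.
Proof.
  intros Hb Hy.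
  assert (HS : forall k, INR (S k) * (INR (S k) + 1) * jain beta (S k) y
      = INR k * borel beta k (y + beta) * y + borel beta k (y + beta) * (2 * y)).
  { intros k. replace (INR (S k) * (INR (S k) + 1) * jain beta (S k) y)
      with ((INR (S k) + 1) * (INR (S k) * jain beta (S k) y)) by ring.
    rewrite mult_jain_S, S_INR. ring. }
  set (i := / (1 - beta)).
  assert (Hi : 0 < i <= 2).
  { unfold i. split; [apply Rinv_0_lt_compat; lra|].
    replace 2 with (/ / 2) by field. apply Rinv_le_contravar; lra. }
  apply ex_series_nonneg_bounded.
  - intros n. apply Rmult_le_pos; [|apply jain_nonneg; lra].
    generalize (pos_INR n). nra.
  - assert (Hshift : forall N, sum_f_R0 (fun k => INR (S k) * (INR (S k) + 1) * jain beta (S k) y) N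
      <= y ^ 2 / (1 - beta) ^ 2 + 10 * y).
    { intros N. rewrite (sum_eq _ _ _ (fun k _ => HS k)), sum_plus, <- !scal_sum.
      assert (H1 := sum_borel_le beta (y + beta) N Hb ltac:(lra)).
      assert (H2 := sum_mult_borel_le beta (y + beta) N Hb ltac:(lra)).
      apply Rle_trans with (y * ((y + beta) / (1 - beta) ^ 2 + beta / (1 - beta) ^ 3)
        + 2 * y * / (1 - beta)).
      - apply Rplus_le_compat; apply Rmult_le_compat_l; lra.
      (* The constant 10: with [i <= 2] and [beta <= / 2], the coefficient
         [beta * i^2 + beta * i^3 + 2 * i] is at most [2 + 4 + 4]. *)
      - replace (y * ((y + beta) / (1 - beta) ^ 2 + beta / (1 - beta) ^ 3) + 2 * y * / (1 - beta))
          with (y ^ 2 / (1 - beta) ^ 2 + y * (beta * i ^ 2 + beta * i ^ 3 + 2 * i))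
          by (unfold i; field; lra).
        apply Rplus_le_compat_l. rewrite Rmult_comm. apply Rmult_le_compat_r; [exact Hy|].
        assert (i ^ 2 <= 4) by nra.
        assert (i ^ 3 <= 8) by (simpl in *; nra).
        assert (0 <= i ^ 2) by nra. assert (0 <= i ^ 3) by (apply pow_le; lra).
        nra. }
    intros [|N].
    + simpl sum_f_R0. rewrite !Rmult_0_l. apply Rplus_le_le_0_compat; [|lra].
      apply Rdiv_le_0_compat; [apply pow2_ge_0|apply pow_lt; lra].
    + rewrite sum_f_R0_shift. specialize (Hshift N). simpl (INR 0). lra.
Qed.

(** * Beta integrals and moments of the Baskakov densities *)

(** The integrand of the Beta function [B(k + 1, b)] after the substitution [u = c t]. With [b] as
    the decay parameter, multiplication by [t] lowers [b] by one and raises [k] by one. *)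
Definition beta_kernel (c b : R) (k : nat) (t : R) : R :=
  (c * t) ^ k / Rpower (1 + c * t) (b + INR k + 1).

(** This is [B(k + 1, b) / c], written through its recursion in [k] so that it needs no Gamma
    function. *)
Fixpoint beta_value (c b : R) (k : nat) : R :=
  match k with
  | O => / (c * b)
  | S j => beta_value c b j * (INR (S j) / (b + INR (S j)))
  end.

Lemma Rpower_affine_derive (c e t : R) : 0 < 1 + c * t ->
  is_derive (fun t => Rpower (1 + c * t) e) t (e * c * Rpower (1 + c * t) (e - 1)).
Proof.
  intros Ht.
  replace (e * c * Rpower (1 + c * t) (e - 1)) with (c * (e * Rpower (1 + c * t) (e - 1))) by ring.
  apply (is_derive_comp (fun x => Rpower x e) (fun t => 1 + c * t)).
  - now apply Rpower_derive.
  - auto_derive; [exact I|ring].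
Qed.

Lemma Rpower_affine_lim (c b : R) : 0 < c -> 0 < b ->
  is_lim (fun t => Rpower (1 + c * t) (- b)) p_infty 0.
Proof.
  intros Hc Hb. unfold Rpower.
  apply (is_lim_comp exp (fun t => - b * ln (1 + c * t)) p_infty 0 m_infty).
  - apply is_lim_exp_m.
  - replace m_infty with (Rbar_mult (- b) p_infty).
    + apply is_lim_scal_l.
      apply (is_lim_comp ln (fun t => 1 + c * t) p_infty p_infty p_infty).
      * apply is_lim_ln_p.
      * apply (is_lim_le_p_loc (fun t => c * t)).
        -- exists 0. intros. lra.
        -- replace p_infty with (Rbar_mult c p_infty) at 2.
           ++ apply is_lim_scal_l, is_lim_id.
           ++ simpl. destruct (Rle_dec 0 c) as [h|h]; [|exfalso; lra].
              destruct (Rle_lt_or_eq_dec 0 c h); [reflexivity|exfalso; lra].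
      * exists 0. intros. discriminate.
    + simpl. destruct (Rle_dec 0 (- b)) as [h|h]; [exfalso; lra|reflexivity].
  - exists 0. intros. discriminate.
Qed.

Lemma beta_kernel_continuous (c b : R) (k : nat) (t : R) : 0 < c -> 0 <= t ->
  continuous (beta_kernel c b k) t.
Proof.
  intros Hc Ht. apply (ex_derive_continuous (V := R_NormedModule)).
  unfold beta_kernel.
  apply ex_derive_div.
  - auto_derive. exact I.
  - eexists. apply Rpower_affine_derive. nra.
  - apply Rgt_not_eq, Rpower_pos.
Qed.

Lemma is_RInt_gen_beta_kernel (c b : R) (k : nat) : 0 < c -> 0 < b ->
  is_RInt_gen (beta_kernel c b k) (at_point 0) (Rbar_locally p_infty) (beta_value c b k).
Proof.
  intros Hc Hb. induction k as [|k IH].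
  - simpl.
    assert (H0 : 0 - - / (c * b) * Rpower (1 + c * 0) (- b) = / (c * b)).
    { rewrite Rmult_0_r, Rplus_0_r. unfold Rpower. rewrite ln_1, Rmult_0_r, exp_0. ring. }
    rewrite <- H0.
    apply (is_RInt_gen_antiderivative (at_point 0) (Rbar_locally p_infty) _ _ 0
      (fun t => - / (c * b) * Rpower (1 + c * t) (- b))).
    + apply Rle_refl.
    + apply Rbar_locally_p_infty_ge.
    + intros t Ht. unfold beta_kernel.
      replace ((c * t) ^ 0 / Rpower (1 + c * t) (b + INR 0 + 1))
        with (- / (c * b) * (- b * c * Rpower (1 + c * t) (- b - 1))).
      * apply (is_derive_scal (fun t => Rpower (1 + c * t) (- b))).
        apply Rpower_affine_derive. nra.
      * unfold Rdiv. rewrite <- Rpower_Ropp. simpl.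
        replace (- (b + 0 + 1)) with (- b - 1) by ring. field. lra.
    + intros t Ht. now apply beta_kernel_continuous.
    + intros P HP. exact (locally_singleton _ P HP).
    + change (is_lim (fun t => - / (c * b) * Rpower (1 + c * t) (- b)) p_infty 0).
      replace (Finite 0) with (Rbar_mult (- / (c * b)) 0) by (simpl; f_equal; ring).
      apply is_lim_scal_l. now apply Rpower_affine_lim.
  (* Integration by parts: the boundary function [(c t)^(k + 1) / (1 + c t)^(b + k + 1)] vanishes at
     0 and at infinity, and its derivative links two consecutive kernels. *)
  - assert (Hd : is_RInt_gen (fun t => c * INR (S k) * beta_kernel c b k t
        - c * (b + INR (S k)) * beta_kernel c b (S k) t)
        (at_point 0) (Rbar_locally p_infty) (0 - 0)).
    { apply (is_RInt_gen_antiderivative (at_point 0) (Rbar_locally p_infty) _ _ 0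
        (fun t => (c * t) ^ S k * Rpower (1 + c * t) (- (b + INR (S k))))).
      - apply Rle_refl.
      - apply Rbar_locally_p_infty_ge.
      - intros t Ht.
        replace (c * INR (S k) * beta_kernel c b k t - c * (b + INR (S k)) * beta_kernel c b (S k) t)
          with (c * INR (S k) * (c * t) ^ k * Rpower (1 + c * t) (- (b + INR (S k)))
            + (c * t) ^ S k * (- (b + INR (S k)) * c * Rpower (1 + c * t) (- (b + INR (S k)) - 1))).
        + apply (is_derive_mult (fun t => (c * t) ^ S k)
            (fun t => Rpower (1 + c * t) (- (b + INR (S k))))).
          * auto_derive; [exact I|]. simpl (INR (S k)). ring.
          * apply Rpower_affine_derive. nra.
          * apply Rmult_comm.
        + unfold beta_kernel, Rdiv. rewrite <- !Rpower_Ropp.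
          replace (- (b + INR k + 1)) with (- (b + INR (S k))) by (rewrite S_INR; ring).
          replace (- (b + INR (S k) + 1)) with (- (b + INR (S k)) - 1) by ring. ring.
      - intros t Ht.
        apply (continuous_minus (V := R_NormedModule) (fun t => c * INR (S k) * beta_kernel c b k t)
          (fun t => c * (b + INR (S k)) * beta_kernel c b (S k) t)).
        + apply (continuous_scal_r (V := R_NormedModule) (c * INR (S k))).
          now apply beta_kernel_continuous.
        + apply (continuous_scal_r (V := R_NormedModule) (c * (b + INR (S k)))).
          now apply beta_kernel_continuous.
      - intros P HP. apply locally_singleton in HP.
        unfold filtermap, at_point. rewrite Rmult_0_r, pow_i, Rmult_0_l by lia. exact HP.
      (* Replacing [c t] by [1 + c t] in the numerator bounds the boundary function by
         [(1 + c t)^(- b)]. *)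
      - apply (filterlim_le_le (F := Rbar_locally p_infty) (fun _ => 0) _
          (fun t => Rpower (1 + c * t) (- b)) 0).
        + exists 0. intros t Ht.
          assert (Hct : 0 < c * t) by nra. split.
          * apply Rmult_le_pos; [apply pow_le; lra|apply Rlt_le, Rpower_pos].
          * apply Rle_trans with ((1 + c * t) ^ S k * Rpower (1 + c * t) (- (b + INR (S k)))).
            -- apply Rmult_le_compat_r; [apply Rlt_le, Rpower_pos|]. apply pow_incr. lra.
            -- rewrite <- Rpower_pow, <- Rpower_plus by lra. right. f_equal. ring.
        + apply filterlim_const.
        + exact (Rpower_affine_lim c b Hc Hb). }
    assert (Hk : 0 < INR (S k)) by (apply lt_0_INR; lia).
    assert (H := is_RInt_gen_scal _ (/ (c * (b + INR (S k)))) _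
      (is_RInt_gen_minus _ _ _ _ (is_RInt_gen_scal _ (c * INR (S k)) _ IH) Hd)).
    replace (beta_value c b (S k)) with
      (scal (/ (c * (b + INR (S k)))) (minus (scal (c * INR (S k)) (beta_value c b k)) (0 - 0))).
    + revert H. apply is_RInt_gen_ext.
      apply filter_forall. intros [x y] t _.
      change (/ (c * (b + INR (S k))) * (c * INR (S k) * beta_kernel c b k t +
        - (c * INR (S k) * beta_kernel c b k t - c * (b + INR (S k)) * beta_kernel c b (S k) t))
        = beta_kernel c b (S k) t).
      field. lra.
    + change (/ (c * (b + INR (S k))) * (c * INR (S k) * beta_value c b k + - (0 - 0))
        = beta_value c b k * (INR (S k) / (b + INR (S k)))).
      field. lra.
Qed.

(** The normalising quotient in [p_nc] with [a = n / c] and [v = k + 1], that is, the generalised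
    binomial coefficient of [a + k - 1] over [k]. *)
Definition gamma_ratio (a : R) (k : nat) : R :=
  Gamma (a + INR (S k) - 1) / (Gamma (INR (S k)) * Gamma a).

Lemma gamma_ratio_0 (a : R) : 1 <= a -> gamma_ratio a 0 = 1.
Proof.
  intros Ha. unfold gamma_ratio. simpl. rewrite Gamma_1.
  replace (a + 1 - 1) with a by ring.
  destruct (Gamma_correct a Ha) as [_ H]. field. lra.
Qed.

Lemma gamma_ratio_S (a : R) (k : nat) : 1 <= a ->
  gamma_ratio a (S k) = gamma_ratio a k * ((a + INR k) / INR (S k)).
Proof.
  intros Ha. unfold gamma_ratio.
  assert (H0 := pos_INR k). assert (HS := S_INR k).
  rewrite (S_INR (S k)).
  rewrite (Gamma_succ (INR (S k))) by lra.
  replace (a + (INR (S k) + 1) - 1) with (a + INR (S k) - 1 + 1) by ring.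
  rewrite (Gamma_succ (a + INR (S k) - 1)) by lra.
  replace (a + INR (S k) - 1) with (a + INR k) by lra.
  destruct (Gamma_correct a Ha) as [_ H1].
  destruct (Gamma_correct (INR (S k))) as [_ H2]; [lra|].
  field. lra.
Qed.

Lemma gamma_ratio_pos (a : R) (k : nat) : 1 <= a -> 0 < gamma_ratio a k.
Proof.
  intros Ha. assert (H0 := pos_INR k). assert (HS := S_INR k).
  apply Rdiv_lt_0_compat; [|apply Rmult_lt_0_compat]; apply Gamma_correct; lra.
Qed.

(** From [k] to [k + 1] the Gamma quotient gains [(a + k) / (k + 1)] and the Beta value the inverse,
    so the product stays at its value for [k = 0]. In the next two lemmas the factor [a + k] cancels
    in the same way, and quotients of integers remain. The Beta integral for the second moment has
    parameter [a - 3], whence [3 < a]. *)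
Lemma moment_0_value (c a : R) (k : nat) : 0 < c -> 3 < a ->
  (a - 1) * c * gamma_ratio a k * beta_value c (a - 1) k = 1.
Proof.
  intros Hc Ha. induction k as [|k IH].
  - rewrite gamma_ratio_0 by lra. simpl. field. lra.
  - rewrite gamma_ratio_S by lra. assert (H0 := pos_INR k). assert (HS := S_INR k).
    change (beta_value c (a - 1) (S k)) with
      (beta_value c (a - 1) k * (INR (S k) / (a - 1 + INR (S k)))).
    transitivity ((a - 1) * c * gamma_ratio a k * beta_value c (a - 1) k); [|exact IH].
    rewrite HS. field. lra.
Qed.

Lemma moment_1_value (c a : R) (k : nat) : 0 < c -> 3 < a ->
  (a - 1) * gamma_ratio a k * beta_value c (a - 2) (S k) = INR (S k) / (c * (a - 2)).
Proof.
  intros Hc Ha. induction k as [|k IH].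
  - rewrite gamma_ratio_0 by lra. simpl. field. lra.
  - rewrite gamma_ratio_S by lra. assert (H0 := pos_INR k). assert (HS := S_INR k).
    change (beta_value c (a - 2) (S (S k))) with
      (beta_value c (a - 2) (S k) * (INR (S (S k)) / (a - 2 + INR (S (S k))))).
    replace (INR (S (S k)) / (c * (a - 2))) with
      (INR (S k) / (c * (a - 2)) * (INR (S (S k)) / INR (S k))) by (field; lra).
    rewrite <- IH. rewrite (S_INR (S k)). rewrite HS. field. lra.
Qed.

Lemma moment_2_value (c a : R) (k : nat) : 0 < c -> 3 < a ->
  (a - 1) / c * gamma_ratio a k * beta_value c (a - 3) (S (S k))
  = INR (S k) * INR (S (S k)) / (c * (a - 2) * (c * (a - 3))).
Proof.
  intros Hc Ha. induction k as [|k IH].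
  - rewrite gamma_ratio_0 by lra. simpl. field. lra.
  - rewrite gamma_ratio_S by lra. assert (H0 := pos_INR k). assert (HS := S_INR k).
    assert (HSS := S_INR (S k)).
    change (beta_value c (a - 3) (S (S (S k)))) with
      (beta_value c (a - 3) (S (S k)) * (INR (S (S (S k))) / (a - 3 + INR (S (S (S k)))))).
    replace (INR (S (S k)) * INR (S (S (S k))) / (c * (a - 2) * (c * (a - 3)))) with
      (INR (S k) * INR (S (S k)) / (c * (a - 2) * (c * (a - 3))) * (INR (S (S (S k))) / INR (S k)))
      by (field; lra).
    rewrite <- IH. rewrite (S_INR (S (S k))), HSS, HS. field. lra.
Qed.

Definition baskakov (n k : nat) (c t : R) : R := (INR n - c) / c * p_nc n (S k) c t.

Lemma baskakov_eq (n k : nat) (c t : R) : 0 < c ->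
  baskakov n k c t = (INR n / c - 1) * c * gamma_ratio (INR n / c) k
    * beta_kernel c (INR n / c - 1) k t.
Proof.
  intros Hc. unfold baskakov, p_nc, beta_kernel. fold (gamma_ratio (INR n / c) k).
  replace (S k - 1)%nat with k by lia.
  replace (INR n / c - 1 + INR k + 1) with (INR n / c + INR (S k) - 1) by (rewrite S_INR; ring).
  field. split; [apply Rgt_not_eq, Rpower_pos|lra].
Qed.

Lemma div_gt_3 (n : nat) (c : R) : 0 < c -> 3 * c < INR n -> 3 < INR n / c.
Proof.
  intros Hc Hn. apply Rmult_lt_reg_r with c; [exact Hc|]. unfold Rdiv. rewrite Rmult_assoc, Rinv_l; lra.
Qed.

Lemma baskakov_nonneg (n k : nat) (c t : R) :
  0 < c -> 3 * c < INR n -> 0 <= t -> 0 <= baskakov n k c t.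
Proof.
  intros Hc Hn Ht. assert (Ha := div_gt_3 n c Hc Hn). rewrite baskakov_eq by exact Hc.
  apply Rmult_le_pos.
  - apply Rlt_le, Rmult_lt_0_compat; [nra|]. apply gamma_ratio_pos. lra.
  - apply Rmult_le_pos; [apply pow_le; nra|].
    apply Rlt_le, Rinv_0_lt_compat, Rpower_pos.
Qed.

Lemma baskakov_continuous (n k : nat) (c t : R) : 0 < c -> 0 <= t -> continuous (baskakov n k c) t.
Proof.
  intros Hc Ht.
  apply (continuous_ext (fun t => (INR n / c - 1) * c * gamma_ratio (INR n / c) k
    * beta_kernel c (INR n / c - 1) k t)).
  - intros x. symmetry. now apply baskakov_eq.
  - apply (continuous_scal_r (V := R_NormedModule)). now apply beta_kernel_continuous.
Qed.

Lemma is_RInt_gen_scal_ext (f g : R -> R) (m l v : R) :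
  is_RInt_gen f (at_point 0) (Rbar_locally p_infty) l ->
  (forall t, g t = m * f t) -> m * l = v ->
  is_RInt_gen g (at_point 0) (Rbar_locally p_infty) v.
Proof.
  intros Hf Hg <-.
  apply (is_RInt_gen_ext (fun t => scal m (f t))).
  - apply filter_forall. intros [x y] t _. symmetry. apply Hg.
  - exact (is_RInt_gen_scal f m l Hf).
Qed.

Lemma baskakov_moment_0 (n k : nat) (c : R) : 0 < c -> 3 * c < INR n ->
  is_RInt_gen (baskakov n k c) (at_point 0) (Rbar_locally p_infty) 1.
Proof.
  intros Hc Hn. assert (Ha := div_gt_3 n c Hc Hn).
  apply (is_RInt_gen_scal_ext (beta_kernel c (INR n / c - 1) k) _
    ((INR n / c - 1) * c * gamma_ratio (INR n / c) k) (beta_value c (INR n / c - 1) k)).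
  - apply is_RInt_gen_beta_kernel; lra.
  - intros t. now apply baskakov_eq.
  - now apply moment_0_value.
Qed.

(** The exponent of the denominator is unchanged, so every moment of a Baskakov density is again a
    Beta integral. *)
Lemma beta_kernel_shift (c b t : R) (k : nat) : 0 < c ->
  t * beta_kernel c b k t = / c * beta_kernel c (b - 1) (S k) t.
Proof.
  intros Hc. unfold beta_kernel. rewrite <- tech_pow_Rmult.
  replace (b - 1 + INR (S k) + 1) with (b + INR k + 1) by (rewrite S_INR; ring).
  field. split; [apply Rgt_not_eq, Rpower_pos|lra].
Qed.

Lemma baskakov_moment_1 (n k : nat) (c : R) : 0 < c -> 3 * c < INR n ->
  is_RInt_gen (fun t => t * baskakov n k c t) (at_point 0) (Rbar_locally p_infty)
    (INR (S k) / (INR n - 2 * c)).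
Proof.
  intros Hc Hn. assert (Ha := div_gt_3 n c Hc Hn).
  replace (INR n - 2 * c) with (c * (INR n / c - 2)) by (field; lra).
  apply (is_RInt_gen_scal_ext (beta_kernel c (INR n / c - 2) (S k)) _
    ((INR n / c - 1) * gamma_ratio (INR n / c) k) (beta_value c (INR n / c - 2) (S k))).
  - apply is_RInt_gen_beta_kernel; lra.
  - intros t. rewrite baskakov_eq by exact Hc.
    replace (t * _) with ((INR n / c - 1) * c * gamma_ratio (INR n / c) k
      * (t * beta_kernel c (INR n / c - 1) k t)) by ring.
    rewrite beta_kernel_shift by exact Hc.
    replace (INR n / c - 1 - 1) with (INR n / c - 2) by ring.
    field. lra.
  - now apply moment_1_value.
Qed.

Lemma baskakov_moment_2 (n k : nat) (c : R) : 0 < c -> 3 * c < INR n ->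
  is_RInt_gen (fun t => t ^ 2 * baskakov n k c t) (at_point 0) (Rbar_locally p_infty)
    (INR (S k) * INR (S (S k)) / ((INR n - 2 * c) * (INR n - 3 * c))).
Proof.
  intros Hc Hn. assert (Ha := div_gt_3 n c Hc Hn).
  replace (INR n - 2 * c) with (c * (INR n / c - 2)) by (field; lra).
  replace (INR n - 3 * c) with (c * (INR n / c - 3)) by (field; lra).
  apply (is_RInt_gen_scal_ext (beta_kernel c (INR n / c - 3) (S (S k))) _
    ((INR n / c - 1) / c * gamma_ratio (INR n / c) k) (beta_value c (INR n / c - 3) (S (S k)))).
  - apply is_RInt_gen_beta_kernel; lra.
  - intros t. rewrite baskakov_eq by exact Hc.
    replace (t ^ 2 * _) with ((INR n / c - 1) * c * gamma_ratio (INR n / c) k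
      * (t * (t * beta_kernel c (INR n / c - 1) k t))) by ring.
    rewrite beta_kernel_shift by exact Hc.
    replace (t * (/ c * _)) with (/ c * (t * beta_kernel c (INR n / c - 1 - 1) (S k) t)) by ring.
    rewrite beta_kernel_shift by exact Hc.
    replace (INR n / c - 1 - 1 - 1) with (INR n / c - 3) by ring.
    field. lra.
  - now apply moment_2_value.
Qed.

(** * The error estimate *)

Lemma RInt_le_RInt_gen (h : R -> R) (L b : R) :
  (forall b, 0 <= b -> ex_RInt h 0 b) -> (forall t, 0 <= t -> 0 <= h t) ->
  is_RInt_gen h (at_point 0) (Rbar_locally p_infty) L -> 0 <= b -> RInt h 0 b <= L.
Proof.
  intros Hex Hpos HL Hb. apply Rnot_lt_le. intros Hlt.
  set (eps := mkposreal (RInt h 0 b - L) (proj2 (Rlt_0_minus _ _) Hlt)).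
  destruct (HL (ball L eps) (locally_ball L eps)) as [Q S HQ [M HM] HQS].
  set (y := Rmax (M + 1) b).
  assert (Hy1 : M < y) by (generalize (Rmax_l (M + 1) b); fold y; lra).
  assert (Hy2 : b <= y) by apply Rmax_r.
  destruct (HQS 0 y HQ (HM y Hy1)) as (v & Hv & Hball).
  simpl in Hv. apply (is_RInt_unique (V := R_CompleteNormedModule)) in Hv.
  assert (Hexy : ex_RInt h b y).
  { apply (ex_RInt_Chasles_2 (V := R_CompleteNormedModule)) with 0; [lra|]. apply Hex. lra. }
  assert (H1 : RInt h 0 y = RInt h 0 b + RInt h b y).
  { rewrite <- (RInt_Chasles h 0 b y); [reflexivity|now apply Hex|exact Hexy]. }
  assert (H2 : 0 <= RInt h b y).
  { apply RInt_ge_0; [exact Hy2|exact Hexy|]. intros t Ht. apply Hpos. lra. }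
  apply Rabs_def2 in Hball. unfold minus, plus, opp in Hball. simpl in Hball. lra.
Qed.

(** The function [g + h] is nonnegative with integrals at most [2 * L], so its integral converges;
    that of [h] is then subtracted. *)
Lemma ex_RInt_gen_dominated (g h : R -> R) (L : R) :
  (forall b, 0 <= b -> ex_RInt g 0 b) -> (forall b, 0 <= b -> ex_RInt h 0 b) ->
  (forall t, 0 <= t -> Rabs (g t) <= h t) ->
  is_RInt_gen h (at_point 0) (Rbar_locally p_infty) L ->
  exists l : R, is_RInt_gen g (at_point 0) (Rbar_locally p_infty) l.
Proof.
  intros Hg Hh Hdom HL.
  assert (Hsum : forall b, 0 <= b -> ex_RInt (fun t => g t + h t) 0 b).
  { intros b Hb. apply (ex_RInt_plus (V := R_NormedModule)); auto. }
  destruct (RInt_gen_nonneg_bounded (at_point 0) _ (fun a => a = 0) (fun t => g t + h t) 0 (2 * L))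
    as [l [Hl _]].
  - reflexivity.
  - intros a ->. split; [reflexivity|lra].
  - intros a b -> Hb. now apply Hsum.
  - intros a t -> Ht. specialize (Hdom t Ht). apply Rabs_le_between in Hdom. lra.
  - intros a b -> Hb. apply Rle_trans with (RInt (fun t => scal 2 (h t)) 0 b).
    + apply RInt_le; [exact Hb|now apply Hsum| |].
      * apply (ex_RInt_scal (V := R_NormedModule)). now apply Hh.
      * intros t Ht. specialize (Hdom t ltac:(lra)). apply Rabs_le_between in Hdom.
        change (g t + h t <= 2 * h t). lra.
    + rewrite (RInt_scal (V := R_CompleteNormedModule)) by now apply Hh.
      change (2 * RInt h 0 b <= 2 * L). apply Rmult_le_compat_l; [lra|].
      apply RInt_le_RInt_gen; [exact Hh| |exact HL|exact Hb].
      intros t Ht. specialize (Hdom t Ht). generalize (Rabs_pos (g t)). lra.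
  - exists (minus l L).
    apply (is_RInt_gen_ext (fun t => minus (g t + h t) (h t))).
    + apply filter_forall. intros [x y] t _. unfold minus, plus, opp. simpl. ring.
    + exact (is_RInt_gen_minus _ _ _ _ Hl HL).
Qed.

(** * The modulus of continuity of a function in the weighted space *)

Lemma rho0_pos (x : R) : 0 < rho0 x.
Proof. unfold rho0. generalize (pow2_ge_0 x). lra. Qed.

(** [f] is continuous on the half line only. Its even extension agrees with it there and is
    continuous on the whole line, as the lemmas on integrals and uniform continuity ask. *)
Lemma continuous_Rabs_extension (f : R -> R) (t : R) :
  (forall x, 0 <= x -> filterlim f (within (fun y => 0 <= y) (locally x)) (locally (f x))) ->
  continuous (fun t => f (Rabs t)) t.
Proof.
  intros Hf. apply (filterlim_comp _ _ _ Rabs f (locally t)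
    (within (fun y => 0 <= y) (locally (Rabs t)))).
  - intros P HP. unfold within in HP.
    assert (H := continuous_Rabs t _ HP). revert H. unfold filtermap. apply filter_imp.
    intros x Hx. apply Hx, Rabs_pos.
  - apply Hf, Rabs_pos.
Qed.

(* Unless [g x] and [g t] are close, [x] and [t] are apart and the smaller one is bounded,
   so that [rho0 x] is controlled by [(t - x)^2]. *)
Lemma weighted_oscillation (g : R -> R) (l e : R) : 0 < e ->
  (forall t, continuous g t) -> is_lim g p_infty l ->
  exists C, 0 <= C /\ forall x t, 0 <= x -> 0 <= t ->
    e < Rabs (g t - g x) -> rho0 x <= C * (t - x) ^ 2.
Proof.
  intros He Hg Hl.
  assert (He2 : 0 < e / 2) by lra.
  apply is_lim_spec in Hl. destruct (Hl (mkposreal _ He2)) as [M HM]. simpl in HM.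
  set (A := Rmax M 0).
  assert (HA : 0 <= A /\ M <= A) by (split; [apply Rmax_r|apply Rmax_l]).
  assert (Hcont : forall x, 0 <= x <= A + 1 -> continuity_pt g x)
    by (intros x _; apply continuity_pt_filterlim, Hg).
  destruct (Heine_cor2 Hcont (mkposreal e He)) as [d Hd].
  simpl in Hd. destruct d as [d Hd0]. simpl in Hd.
  set (m := Rmin d 1).
  assert (Hm : 0 < m /\ m <= d /\ m <= 1).
  { split; [apply Rmin_glb_lt; lra|]. split; [apply Rmin_l|apply Rmin_r]. }
  (* The claim will follow from [rho0 x <= 1 + 2 (A + 1)^2 + 2 (t - x)^2], where the constant part
     is absorbed by means of [m <= |t - x|]. *)
  exists ((1 + 2 * (A + 1) ^ 2) / m ^ 2 + 2). split.
  { apply Rplus_le_le_0_compat; [|lra].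
    apply Rdiv_le_0_compat; [generalize (pow2_ge_0 (A + 1)); lra|apply pow_lt; lra]. }
  intros x t Hx Ht Hosc.
  assert (Hsmall : x <= A + 1 \/ t <= A + 1).
  { destruct (Rle_lt_dec x (A + 1)) as [h|h]; [now left|].
    destruct (Rle_lt_dec t (A + 1)) as [h'|h']; [now right|exfalso].
    assert (H1 := HM x ltac:(lra)). assert (H2 := HM t ltac:(lra)).
    apply Rabs_def2 in H1. apply Rabs_def2 in H2.
    assert (Rabs (g t - g x) < e) by (apply Rabs_def1; lra). lra. }
  (* Points closer than [m <= 1] either both lie in [[0, A + 1]], where uniform continuity applies,
     or both exceed [A], where [g] is within [e / 2] of its limit. *)
  assert (Hfar : m <= Rabs (t - x)).
  { apply Rnot_lt_le. intros Hlt.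
    destruct (Rle_lt_dec x A) as [h|h].
    - assert (t <= A + 1) by (apply Rabs_def2 in Hlt; lra).
      assert (Rabs (g t - g x) < e) by (apply Hd; lra). lra.
    - destruct (Rle_lt_dec t A) as [h'|h'].
      + assert (x <= A + 1) by (apply Rabs_def2 in Hlt; lra).
        assert (Rabs (g t - g x) < e) by (apply Hd; lra). lra.
      + assert (H1 := HM x ltac:(lra)). assert (H2 := HM t ltac:(lra)).
        apply Rabs_def2 in H1. apply Rabs_def2 in H2.
        assert (Rabs (g t - g x) < e) by (apply Rabs_def1; lra). lra. }
  assert (Hsq : m ^ 2 <= (t - x) ^ 2).
  { rewrite <- (pow2_abs (t - x)). apply pow_incr. lra. }
  assert (Hx2 : x ^ 2 <= 2 * (A + 1) ^ 2 + 2 * (t - x) ^ 2).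
  { destruct Hsmall as [h|h].
    - assert (x ^ 2 <= (A + 1) ^ 2) by (apply pow_incr; lra).
      generalize (pow2_ge_0 (t - x)) (pow2_ge_0 (A + 1)). lra.
    - assert (t ^ 2 <= (A + 1) ^ 2) by (apply pow_incr; lra).
      generalize (pow2_ge_0 (t + (t - x))). nra. }
  unfold rho0.
  assert (H1 : 1 + 2 * (A + 1) ^ 2 <= (1 + 2 * (A + 1) ^ 2) / m ^ 2 * (t - x) ^ 2).
  { unfold Rdiv. rewrite Rmult_assoc. rewrite <- (Rmult_1_r (1 + _)) at 1.
    apply Rmult_le_compat_l; [generalize (pow2_ge_0 (A + 1)); lra|].
    assert (Hm2 : 0 < m ^ 2) by (apply pow_lt; lra).
    rewrite <- (Rinv_l (m ^ 2)) by lra.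
    apply Rmult_le_compat_l; [apply Rlt_le, Rinv_0_lt_compat, Hm2|exact Hsq]. }
  lra.
Qed.

(** With [g = f / rho0], the difference [f t - f x] equals [(g t - g x) rho0 x + g t (t^2 - x^2)].
    The first term is at most [e / 2 * rho0 x] unless [g] oscillates, which [weighted_oscillation]
    handles; the second is split by AM-GM. *)
Lemma C_rho0_modulus (f : R -> R) (e : R) : C_rho0 f -> 0 < e ->
  exists C, 0 <= C /\ forall x t, 0 <= x -> 0 <= t ->
    Rabs (f t - f x) <= e * rho0 x + C * (t - x) ^ 2.
Proof.
  intros (Hcont & [M0 HM0] & [l Hl]) He.
  set (M := Rabs M0).
  assert (HMp : 0 <= M) by apply Rabs_pos.
  set (g := fun t => f (Rabs t) / rho0 t).
  assert (Hgpos : forall t, 0 <= t -> f t = g t * rho0 t).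
  { intros t Ht. unfold g. rewrite Rabs_pos_eq by exact Ht. field. apply Rgt_not_eq, rho0_pos. }
  assert (HgM : forall t, 0 <= t -> Rabs (g t) <= M).
  { intros t Ht. apply Rmult_le_reg_r with (rho0 t); [apply rho0_pos|].
    rewrite <- (Rabs_pos_eq (rho0 t)) at 1 by (apply Rlt_le, rho0_pos).
    rewrite <- Rabs_mult, <- Hgpos by exact Ht.
    apply Rle_trans with (1 := HM0 t Ht).
    apply Rmult_le_compat_r; [apply Rlt_le, rho0_pos|apply Rle_abs]. }
  destruct (weighted_oscillation g l (e / 2)) as (C & HC & Hosc).
  - lra.
  - intros t. unfold g, Rdiv.
    apply (continuous_mult (fun t => f (Rabs t)) (fun t => / rho0 t)).
    + now apply continuous_Rabs_extension.
    + apply (ex_derive_continuous (V := R_NormedModule)). unfold rho0. auto_derive.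
      generalize (rho0_pos t). unfold rho0. simpl. lra.
  - apply is_lim_ext_loc with (2 := Hl). exists 0. intros x Hx.
    unfold g. now rewrite Rabs_pos_eq by lra.
  (* The AM-GM parameter, chosen so that [M * d <= e / 2]; [M + 1] keeps the denominator positive
     when [M = 0]. *)
  - set (d := e / (2 * (M + 1))).
    assert (Hd : 0 < d) by (apply Rdiv_lt_0_compat; lra).
    assert (Hid : 0 < / d) by now apply Rinv_0_lt_compat.
    assert (HMd : M * d <= e / 2).
    { replace (e / 2) with ((M + 1) * d) by (unfold d; field; lra). nra. }
    exists (2 * M * C + M * (1 + / d)). split.
    { apply Rplus_le_le_0_compat; apply Rmult_le_pos; lra. }
    intros x t Hx Ht.
    replace (f t - f x) with ((g t - g x) * rho0 x + g t * (t ^ 2 - x ^ 2))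
      by (rewrite (Hgpos t Ht), (Hgpos x Hx); unfold rho0; ring).
    apply Rle_trans with (1 := Rabs_triang _ _). rewrite !Rabs_mult.
    rewrite (Rabs_pos_eq (rho0 x)) by (apply Rlt_le, rho0_pos).
    assert (Hrho := rho0_pos x). assert (Hsq := pow2_ge_0 (t - x)).
    assert (H1 : Rabs (g t - g x) * rho0 x <= e / 2 * rho0 x + 2 * M * C * (t - x) ^ 2).
    { destruct (Rle_lt_dec (Rabs (g t - g x)) (e / 2)) as [h|h].
      - assert (0 <= 2 * M * C * (t - x) ^ 2) by (apply Rmult_le_pos; [apply Rmult_le_pos; lra|exact Hsq]).
        assert (Rabs (g t - g x) * rho0 x <= e / 2 * rho0 x) by (apply Rmult_le_compat_r; lra).
        lra.
      - specialize (Hosc x t Hx Ht h).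
        assert (Hb : Rabs (g t - g x) <= 2 * M).
        { unfold Rminus. apply Rle_trans with (1 := Rabs_triang _ _). rewrite Rabs_Ropp.
          generalize (HgM t Ht) (HgM x Hx). lra. }
        assert (Rabs (g t - g x) * rho0 x <= 2 * M * (C * (t - x) ^ 2)).
        { apply Rmult_le_compat; [apply Rabs_pos|lra|exact Hb|exact Hosc]. }
        nra. }
    assert (H2 : Rabs (t ^ 2 - x ^ 2) <= (1 + / d) * (t - x) ^ 2 + d * rho0 x).
    { (* AM-GM: [2 x |t - x| <= d x^2 + (t - x)^2 / d] *)
      assert (Ham : 2 * x * Rabs (t - x) <= d * x ^ 2 + / d * (t - x) ^ 2).
      { assert (H := pow2_ge_0 (d * x - Rabs (t - x))).
        rewrite <- (pow2_abs (t - x)).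
        apply Rmult_le_reg_l with d; [exact Hd|].
        replace (d * (d * x ^ 2 + / d * Rabs (t - x) ^ 2))
          with (d ^ 2 * x ^ 2 + Rabs (t - x) ^ 2) by (field; lra).
        nra. }
      replace (t ^ 2 - x ^ 2) with ((t - x) ^ 2 + 2 * x * (t - x)) by ring.
      apply Rle_trans with (1 := Rabs_triang _ _).
      rewrite (Rabs_pos_eq _ Hsq), Rabs_mult, (Rabs_pos_eq (2 * x)) by lra.
      unfold rho0. nra. }
    assert (H3 : Rabs (g t) * Rabs (t ^ 2 - x ^ 2) <= M * ((1 + / d) * (t - x) ^ 2 + d * rho0 x)).
    { apply Rmult_le_compat; [apply Rabs_pos|apply Rabs_pos|now apply HgM|exact H2]. }
    nra.
Qed.

(** * From the densities to the operator *)

Lemma ex_RInt_baskakov_mult (n k : nat) (c b : R) (h : R -> R) : 0 < c -> 0 <= b ->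
  (forall t, continuous h t) -> ex_RInt (fun t => baskakov n k c t * h t) 0 b.
Proof.
  intros Hc Hb Hh. apply (ex_RInt_continuous (V := R_CompleteNormedModule)).
  rewrite Rmin_left by exact Hb. intros t Ht.
  apply (continuous_mult (baskakov n k c) h); [|apply Hh].
  now apply baskakov_continuous.
Qed.

Lemma is_RInt_gen_baskakov_quadratic (n k : nat) (c a0 a1 a2 : R) : 0 < c -> 3 * c < INR n ->
  is_RInt_gen (fun t => baskakov n k c t * (a0 + a1 * t + a2 * t ^ 2))
    (at_point 0) (Rbar_locally p_infty)
    (a0 + a1 * (INR (S k) / (INR n - 2 * c))
      + a2 * (INR (S k) * INR (S (S k)) / ((INR n - 2 * c) * (INR n - 3 * c)))).
Proof.
  intros Hc Hn.
  assert (H0 := is_RInt_gen_scal _ a0 _ (baskakov_moment_0 n k c Hc Hn)).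
  assert (H1 := is_RInt_gen_scal _ a1 _ (baskakov_moment_1 n k c Hc Hn)).
  assert (H2 := is_RInt_gen_scal _ a2 _ (baskakov_moment_2 n k c Hc Hn)).
  assert (H := is_RInt_gen_plus _ _ _ _ (is_RInt_gen_plus _ _ _ _ H0 H1) H2).
  apply (is_RInt_gen_scal_ext _ _ 1 _ _ H).
  - intros t. change (baskakov n k c t * (a0 + a1 * t + a2 * t ^ 2)
      = 1 * (a0 * baskakov n k c t + a1 * (t * baskakov n k c t) + a2 * (t ^ 2 * baskakov n k c t))).
    ring.
  - rewrite Rmult_1_l.
    transitivity (a0 * 1 + a1 * (INR (S k) / (INR n - 2 * c))
      + a2 * (INR (S k) * INR (S (S k)) / ((INR n - 2 * c) * (INR n - 3 * c)))); [reflexivity|].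
    now rewrite Rmult_1_r.
Qed.

Lemma baskakov_integral_error (n k : nat) (c e C x : R) (f : R -> R) :
  0 < c -> 3 * c < INR n -> C_rho0 f -> 0 <= x ->
  (forall t, 0 <= t -> Rabs (f t - f x) <= e * rho0 x + C * (t - x) ^ 2) ->
  Rabs ((INR n - c) / c * RInt_gen (fun t => p_nc n (S k) c t * f t)
          (at_point 0) (Rbar_locally p_infty) - f x)
  <= e * rho0 x + C * (INR (S k) * INR (S (S k)) / ((INR n - 2 * c) * (INR n - 3 * c))
       - 2 * x * (INR (S k) / (INR n - 2 * c)) + x ^ 2).
Proof.
  intros Hc Hn (Hcont & [M HM] & _) Hx Herr.
  destruct (fun H1 H2 H3 => ex_RInt_gen_dominated (fun t => baskakov n k c t * f t)
    (fun t => baskakov n k c t * (M + 0 * t + M * t ^ 2)) _ H1 H2 H3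
    (is_RInt_gen_baskakov_quadratic n k c M 0 M Hc Hn)) as [J HJ].
  - intros b Hb. apply (ex_RInt_ext (fun t => baskakov n k c t * f (Rabs t))).
    + intros t. rewrite Rmin_left by exact Hb. intros Ht. now rewrite Rabs_pos_eq by lra.
    + apply (ex_RInt_baskakov_mult n k c b (fun t => f (Rabs t))); [exact Hc|exact Hb|].
      intros t. now apply continuous_Rabs_extension.
  - intros b Hb. apply (ex_RInt_baskakov_mult n k c b (fun t => M + 0 * t + M * t ^ 2));
      [exact Hc|exact Hb|].
    intros t. apply (ex_derive_continuous (V := R_NormedModule)). auto_derive. exact I.
  - intros t Ht. rewrite Rabs_mult, (Rabs_pos_eq (baskakov n k c t)) by now apply baskakov_nonneg.
    apply Rmult_le_compat_l; [now apply baskakov_nonneg|].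
    replace (M + 0 * t + M * t ^ 2) with (M * rho0 t) by (unfold rho0; ring). now apply HM.
  - assert (HI : RInt_gen (fun t => p_nc n (S k) c t * f t) (at_point 0) (Rbar_locally p_infty)
        = c / (INR n - c) * J).
    { apply (is_RInt_gen_unique (V := R_CompleteNormedModule)).
      apply (is_RInt_gen_scal_ext _ _ (c / (INR n - c)) J _ HJ); [|reflexivity].
      intros t. unfold baskakov. field. lra. }
    rewrite HI.
    replace ((INR n - c) / c * (c / (INR n - c) * J)) with J by (field; lra).
    assert (H1 : is_RInt_gen (fun t => baskakov n k c t * (f t - f x))
        (at_point 0) (Rbar_locally p_infty) (J - f x)).
    { assert (H := is_RInt_gen_minus _ _ _ _ HJ
        (is_RInt_gen_scal _ (f x) _ (baskakov_moment_0 n k c Hc Hn))).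
      apply (is_RInt_gen_scal_ext _ _ 1 _ _ H).
      - intros t. change (baskakov n k c t * (f t - f x)
          = 1 * (baskakov n k c t * f t - f x * baskakov n k c t)). ring.
      - change (1 * (J - f x * 1) = J - f x). ring. }
    (* The coefficients are those of [e * rho0 x + C * (t - x)^2] as a polynomial in [t]. *)
    assert (H2 := is_RInt_gen_baskakov_quadratic n k c (e * rho0 x + C * x ^ 2) (- 2 * x * C) C Hc Hn).
    match goal with |- _ <= ?r => match type of H2 with is_RInt_gen _ _ _ ?v =>
      replace r with v by ring end end.
    apply (RInt_gen_norm (V := R_CompleteNormedModule) (Fa := at_point 0)
      (Fb := Rbar_locally p_infty) _ _ _ _) with (3 := H1) (4 := H2).
    + apply Filter_prod with (fun a => a = 0) (fun b => 0 <= b).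
      * reflexivity.
      * apply Rbar_locally_p_infty_ge.
      * intros a b -> Hb. exact Hb.
    + apply Filter_prod with (fun a => a = 0) (fun b => 0 <= b).
      * reflexivity.
      * apply Rbar_locally_p_infty_ge.
      * intros a b -> Hb t [Ht _]. simpl in Ht.
        change (Rabs (baskakov n k c t * (f t - f x)) <= baskakov n k c t
          * (e * rho0 x + C * x ^ 2 + - 2 * x * C * t + C * t ^ 2)).
        rewrite Rabs_mult, (Rabs_pos_eq (baskakov n k c t)) by now apply baskakov_nonneg.
        apply Rmult_le_compat_l; [now apply baskakov_nonneg|].
        apply Rle_trans with (1 := Herr t Ht). right. ring.
Qed.

(** The sum of the coefficients of [x^2] and [x] in the upper bound for [D((t - x)^2)(x)]. The [- 1]
    is [- 2 + 1], from the first moment and from [x^2]; the 10 comes from [jain_second_moment]. *)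
Definition second_moment_error (c b : R) (n : nat) : R :=
  INR n ^ 2 / ((1 - b) ^ 2 * ((INR n - 2 * c) * (INR n - 3 * c))) - 1
  + 10 * INR n / ((INR n - 2 * c) * (INR n - 3 * c)).

Lemma D_op_error (n : nat) (c b e C x : R) (f : R -> R) :
  0 < c -> 3 * c < INR n -> 0 <= b <= / 2 -> C_rho0 f -> 0 <= x -> 0 <= C ->
  (forall t, 0 <= t -> Rabs (f t - f x) <= e * rho0 x + C * (t - x) ^ 2) ->
  Rabs (D_op n c b f x - f x) <= (e + C * second_moment_error c b n) * rho0 x.
Proof.
  intros Hc Hn Hb Hf Hx HC Herr.
  set (y := INR n * x).
  assert (Hy : 0 <= y) by (apply Rmult_le_pos; lra).
  set (w := fun v => jain b v y).
  set (m := fun v => match v with O => f 0 | S k => (INR n - c) / c *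
    RInt_gen (fun t => p_nc n (S k) c t * f t) (at_point 0) (Rbar_locally p_infty) end).
  set (q := (INR n - 2 * c) * (INR n - 3 * c)).
  assert (Hq : 0 < q) by (apply Rmult_lt_0_compat; lra).
  (* The integrated error bound as one formula in [v]; at [v = 0] it reduces to the pointwise bound
     at [t = 0]. *)
  set (E := fun v => (e * rho0 x + C * x ^ 2)
    - 2 * x * C / (INR n - 2 * c) * INR v + C / q * (INR v * (INR v + 1))).
  assert (Hm : forall v, Rabs (m v - f x) <= E v).
  { intros [|k]; unfold m, E.
    - simpl (INR 0). apply Rle_trans with (1 := Herr 0 ltac:(lra)). right. ring.
    - apply Rle_trans with (1 := baskakov_integral_error n k c e C x f Hc Hn Hf Hx Herr).
      right. rewrite (S_INR (S k)). unfold q. field. lra. }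
  assert (Hw : forall v, 0 <= w v) by (intros v; apply jain_nonneg; lra).
  assert (Hw1 := is_series_jain b y Hb Hy).
  destruct (jain_first_moment b y Hb Hy) as [Hex1 Hm1].
  destruct (jain_second_moment b y Hb Hy) as [Hex2 Hm2].
  fold w in Hw1.
  set (m1 := Series (fun v => INR v * jain b v y)) in *.
  set (m2 := Series (fun v => INR v * (INR v + 1) * jain b v y)) in *.
  assert (HE : is_series (fun v => w v * E v) ((e * rho0 x + C * x ^ 2)
      + (- (2 * x * C / (INR n - 2 * c)) * m1 + C / q * m2))).
  { assert (Heq : forall v, (e * rho0 x + C * x ^ 2) * w v
      + (- (2 * x * C / (INR n - 2 * c)) * (INR v * jain b v y)
         + C / q * (INR v * (INR v + 1) * jain b v y)) = w v * E v)
      by (intros v; unfold E, w; ring).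
    apply (is_series_ext _ _ _ Heq).
    apply (is_series_plus (V := R_NormedModule) (fun v => (e * rho0 x + C * x ^ 2) * w v)).
    - assert (H : is_series (fun v => (e * rho0 x + C * x ^ 2) * w v) ((e * rho0 x + C * x ^ 2) * 1))
        by exact (is_series_scal_l (e * rho0 x + C * x ^ 2) w 1 Hw1).
      rewrite Rmult_1_r in H. exact H.
    - apply (is_series_plus (V := R_NormedModule)
        (fun v => - (2 * x * C / (INR n - 2 * c)) * (INR v * jain b v y))).
      + exact (is_series_scal_l _ _ _ (Series_correct _ Hex1)).
      + exact (is_series_scal_l _ _ _ (Series_correct _ Hex2)). }
  set (d := fun v => w v * (m v - f x)).
  assert (Hd : forall v, Rabs (d v) <= w v * E v).
  { intros v. unfold d. rewrite Rabs_mult, (Rabs_pos_eq (w v)) by apply Hw.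
    apply Rmult_le_compat_l; [apply Hw|apply Hm]. }
  assert (Hexd : ex_series (fun v => Rabs (d v))).
  { apply (ex_series_le (V := R_CompleteNormedModule)) with (b := fun v => w v * E v).
    - intros v. change (Rabs (Rabs (d v)) <= w v * E v). rewrite Rabs_Rabsolu. apply Hd.
    - eexists. exact HE. }
  assert (Hexwm : is_series (fun v => w v * m v) (Series d + f x * 1)).
  { assert (Heq : forall v, d v + f x * w v = w v * m v) by (intros v; unfold d; ring).
    apply (is_series_ext _ _ _ Heq).
    apply (is_series_plus (V := R_NormedModule) d).
    - apply Series_correct, ex_series_Rabs, Hexd.
    - exact (is_series_scal_l (f x) w 1 Hw1). }
  (* The series in [D_op] starts at [v = 1]; its separate summand [exp (- n x) * f 0] is the term
     [v = 0] of the sum of [w v * m v]. *)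
  assert (HD : D_op n c b f x = Series d + f x).
  { unfold D_op. fold y.
    rewrite <- Series_scal_l.
    rewrite (Series_ext _ (fun k => w (S k) * m (S k))).
    - assert (H := Series_incr_1 (fun v => w v * m v) (ex_intro _ _ Hexwm)).
      rewrite (is_series_unique _ _ Hexwm) in H.
      unfold w at 1 in H. rewrite jain_0 in H. simpl (m 0%nat) in H. lra.
    - intros k. unfold w, m. rewrite jain_S. ring. }
  rewrite HD. replace (Series d + f x - f x) with (Series d) by ring.
  apply Rle_trans with (1 := Series_Rabs d Hexd).
  apply Rle_trans with (Series (fun v => w v * E v)).
  { apply Series_le; [|eexists; exact HE]. intros v. split; [apply Rabs_pos|apply Hd]. }
  rewrite (is_series_unique _ _ HE).
  assert (HCq : 0 <= C / q) by now apply Rdiv_le_0_compat.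
  assert (H2 : C / q * m2 <= C / q * (y ^ 2 / (1 - b) ^ 2 + 10 * y))
    by now apply Rmult_le_compat_l.
  (* The lower bound [m1 >= n x] and [n / (n - 2 c) >= 1] make the mixed term cancel at least
     [2 C x^2]. *)
  assert (H1 : 2 * C * x ^ 2 <= 2 * x * C / (INR n - 2 * c) * m1).
  { apply Rle_trans with (2 * x * C / (INR n - 2 * c) * y).
    - unfold y. replace (2 * x * C / (INR n - 2 * c) * (INR n * x))
        with (2 * C * x ^ 2 * (INR n / (INR n - 2 * c))) by (field; lra).
      rewrite <- (Rmult_1_r (2 * C * x ^ 2)) at 1.
      apply Rmult_le_compat_l; [generalize (pow2_ge_0 x); nra|].
      apply Rmult_le_reg_r with (INR n - 2 * c); [lra|].
      unfold Rdiv. rewrite Rmult_assoc, Rinv_l; lra.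
    - apply Rmult_le_compat_l; [|exact Hm1].
      apply Rdiv_le_0_compat; [|lra]. apply Rmult_le_pos; lra. }
  set (p := INR n ^ 2 / ((1 - b) ^ 2 * q)). set (r := 10 * INR n / q).
  assert (Hy2 : C / q * (y ^ 2 / (1 - b) ^ 2 + 10 * y) = C * (p * x ^ 2 + r * x)).
  { unfold p, r, y. field. lra. }
  assert (Hsm : second_moment_error c b n = p - 1 + r) by reflexivity.
  (* Nonnegativity of [p - 1] allows [x^2] to be replaced by [rho0 x] in its term. *)
  assert (Hp : 1 <= p).
  { assert (Hb2 : 0 < (1 - b) ^ 2) by (apply pow_lt; lra).
    assert (Hden : 0 < (1 - b) ^ 2 * q) by now apply Rmult_lt_0_compat.
    apply Rmult_le_reg_r with ((1 - b) ^ 2 * q); [exact Hden|].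
    unfold p, Rdiv. rewrite Rmult_assoc, Rinv_l, Rmult_1_r, Rmult_1_l by lra.
    assert ((1 - b) ^ 2 <= 1) by nra.
    assert (q <= INR n ^ 2) by (unfold q; nra). nra. }
  assert (Hr : 0 <= r) by (apply Rdiv_le_0_compat; lra).
  assert (Hxr : x <= rho0 x) by (unfold rho0; generalize (pow2_ge_0 (x - 1)); nra).
  assert (Hxr2 : x ^ 2 <= rho0 x) by (unfold rho0; lra).
  rewrite Hsm.
  assert (H3 : C * ((p - 1) * x ^ 2 + r * x) <= C * ((p - 1 + r) * rho0 x)).
  { apply Rmult_le_compat_l; [exact HC|]. nra. }
  nra.
Qed.

Lemma second_moment_error_lim (c : R) (b : nat -> R) : 0 < c -> is_lim_seq b 0 ->
  is_lim_seq (fun n => second_moment_error c (b n) n) 0.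
Proof.
  intros Hc Hb.
  assert (Hr : is_lim_seq (fun n => / INR n) 0).
  { apply (is_lim_seq_inv INR p_infty); [apply is_lim_seq_INR|discriminate]. }
  assert (Hlin : forall k, is_lim_seq (fun n => 1 - k * / INR n) 1).
  { intros k. replace (Finite 1) with (Finite (1 - k * 0)) by (f_equal; ring).
    apply is_lim_seq_minus'; [apply is_lim_seq_const|].
    apply is_lim_seq_mult'; [apply is_lim_seq_const|exact Hr]. }
  assert (Hq : is_lim_seq (fun n => / ((1 - 2 * c * / INR n) * (1 - 3 * c * / INR n))) 1).
  { replace (Finite 1) with (Rbar_inv (1 * 1)) by (simpl; f_equal; field).
    apply is_lim_seq_inv; [|intros H; injection H; lra].
    apply is_lim_seq_mult'; apply Hlin. }
  assert (Hb2 : is_lim_seq (fun n => / ((1 - b n) * (1 - b n))) 1).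
  { replace (Finite 1) with (Rbar_inv ((1 - 0) * (1 - 0))) by (simpl; f_equal; field).
    apply is_lim_seq_inv; [|intros H; injection H; lra].
    apply is_lim_seq_mult'; (apply is_lim_seq_minus'; [apply is_lim_seq_const|exact Hb]). }
  assert (Hlim : is_lim_seq (fun n =>
     / ((1 - b n) * (1 - b n)) * / ((1 - 2 * c * / INR n) * (1 - 3 * c * / INR n)) - 1
     + 10 * / INR n * / ((1 - 2 * c * / INR n) * (1 - 3 * c * / INR n))) 0).
  { replace (Finite 0) with (Finite (1 * 1 - 1 + 10 * 0 * 1)) by (f_equal; ring).
    apply is_lim_seq_plus'.
    - apply is_lim_seq_minus'; [|apply is_lim_seq_const].
      now apply is_lim_seq_mult'.
    - apply is_lim_seq_mult'; [|exact Hq].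
      apply is_lim_seq_mult'; [apply is_lim_seq_const|exact Hr]. }
  (* The form in powers of [1 / n] agrees with the definition once no denominator vanishes, which
     [n > 3 c] and [|b n| < 1] ensure. *)
  apply is_lim_seq_ext_loc with (2 := Hlim).
  apply is_lim_seq_spec in Hb. destruct (Hb (mkposreal _ Rlt_0_1)) as [N1 HN1].
  assert (HI := proj2 (is_lim_seq_spec INR p_infty) is_lim_seq_INR (3 * c)).
  destruct HI as [N2 HN2].
  exists (max N1 N2). intros n Hn.
  specialize (HN1 n ltac:(lia)). specialize (HN2 n ltac:(lia)). simpl in HN1.
  apply Rabs_def2 in HN1. unfold second_moment_error.
  field. repeat split; lra.
Qed.

Theorem theorem3 (c : R) (beta : nat -> R) (f : R -> R) :
  0 < c ->
  (forall n, 0 <= beta n < 1) ->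
  is_lim_seq beta 0 ->
  C_rho0 f ->
  forall eps : R, 0 < eps ->
    exists N : nat, forall n : nat, (N <= n)%nat -> 3 * c < INR n ->
      Rbar_le (wnorm (fun x => D_op n c (beta n) f x - f x)) (Finite eps).
Proof.
  intros Hc Hbeta Hlim Hf eps Heps.
  destruct (C_rho0_modulus f (eps / 2) Hf) as (C & HC & Hmod); [lra|].
  assert (Hdelta : is_lim_seq (fun n => C * second_moment_error c (beta n) n) (C * 0)).
  { apply is_lim_seq_mult'; [apply is_lim_seq_const|].
    now apply second_moment_error_lim. }
  rewrite Rmult_0_r in Hdelta.
  apply is_lim_seq_spec in Hdelta. apply is_lim_seq_spec in Hlim.
  (* Half of [eps] goes to the modulus of [f], half to the second moment; [N2] ensures
     [beta n < / 2], where the Jain sums are available. *)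
  destruct (Hdelta (mkposreal (eps / 2) ltac:(lra))) as [N1 HN1].
  destruct (Hlim (mkposreal (/ 2) ltac:(lra))) as [N2 HN2].
  exists (max N1 N2). intros n Hn Hcn.
  specialize (HN1 n ltac:(lia)). specialize (HN2 n ltac:(lia)). simpl in HN1, HN2.
  apply Rabs_def2 in HN1. apply Rabs_def2 in HN2.
  apply Lub_Rbar_correct. intros r (x & Hx & ->). simpl.
  apply Rmult_le_reg_r with (rho0 x); [apply rho0_pos|].
  unfold Rdiv. rewrite Rmult_assoc, Rinv_l, Rmult_1_r by apply Rgt_not_eq, rho0_pos.
  apply Rle_trans with ((eps / 2 + C * second_moment_error c (beta n) n) * rho0 x).
  - apply D_op_error; try assumption.
    + specialize (Hbeta n). lra.
    + intros t Ht. now apply Hmod.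
  - apply Rmult_le_compat_r; [apply Rlt_le, rho0_pos|]. lra.
Qed.
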